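(* Let $k$ be a field, let $\mathscr{A}$ be a hyperplane arrangement in $\mathbb{P}^n_k$ consisting of $d\ge 2$ distinct hyperplanes, and let $M(\mathscr{A})=\mathbb{P}^n\smallsetminus A$ be the complement of the union $A$ of the hyperplanes. Let $\mathbb{L}$ be the class of the affine line $\mathbb{A}^1_k$ in the Grothendieck ring $K(\mathrm{Var}_k)$ of $k$-varieties. Then $$[M(\mathscr{A})]=\underline{\chi_{\widehat{\mathscr{A}}}}(\mathbb{L})\quad\text{in } K(\mathrm{Var}_k).$$
   Context: An arrangement $\mathscr{A}$ in $\mathbb{P}^n$ is a finite collection of distinct hyperplanes $H_1,\dots,H_d$; $A\subseteq\mathbb{P}^n$ is their union. $\widehat{\mathscr{A}}$ denotes the corresponding central arrangement of hyperplanes $\widehat{H}_i$ (the linear hyperplanes corresponding to the $H_i$) in $V=k^{n+1}$. $L(\widehat{\mathscr{A}})$ is the poset of all intersections $\bigcap_{i\in J}\widehat{H}_i$, $J\subseteq\{1,\dots,d\}$, ordered by reverse inclusion ($y\le x$ iff $y\supseteq x$); the case $J=\emptyset$ gives $V$, the minimum, denoted $0\in L(\widehat{\mathscr{A}})$. The Möbius function is defined by $\mu(x,x)=1$ and $\sum_{x\le z\le y}\mu(x,z)=0$ for $x<y$; write $\mu(x)=\mu(0,x)$. The characteristic polynomial is $\chi_{\widehat{\mathscr{A}}}(t)=\sum_{x\in L(\widehat{\mathscr{A}})}\mu(x)t^{\dim x}$. It satisfies $\chi_{\widehat{\mathscr{A}}}(1)=0$, and $\underline{\chi_{\widehat{\mathscr{A}}}}(t):=\chi_{\widehat{\mathscr{A}}}(t)/(t-1)$,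 a polynomial with integer coefficients. *)

(* Defs.v *)
From HB Require Import structures.
From mathcomp Require Import all_boot all_order all_algebra.
From mathcomp Require Import boolp.
From mathcomp Require Import mpoly ring.

(* A k-scheme is represented by its functor of points on commutative           *)
(* k-algebras (Demazure-Gabriel, Groupes algebriques, I.1): a k-functor that   *)
(* is a Zariski sheaf and has a cover by affine open subfunctors. A variety    *)
(* over k is a separated scheme of finite type over k (not required to be      *)
(* reduced or irreducible, so that products are products of functors).         *)
(* [comAlgType k] consists of the nonzero commutative k-algebras. Nothing is   *)
(* lost, since every scheme has exactly one point with values in the zero      *)
(* ring; the empty scheme is the functor without any point.                    *)

Set Implicit Arguments.
Unset Strict Implicit.
Unset Printing Implicit Defensive.
Import GRing.Theory.

Local Open Scope ring_scope.
Local Open Scope quotient_scope.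

Lemma lrmorphism_ex (k : fieldType) (A B : comAlgType k) (f : A -> B) :
    {morph f : x y / x + y} -> {morph f : x y / x * y} ->
    (forall c : k, f c%:A = c%:A) ->
  exists g : {lrmorphism A -> B}, g =1 f.
Proof.
move=> fD fM fc.
have f0 : f 0 = 0 by have := fc 0; rewrite !scale0r.
have fB : zmod_morphism f.
  move=> x y; rewrite fD; congr (_ + _); apply/eqP.
  by rewrite -subr_eq0 opprK -fD addNr f0.
have f1 : monoid_morphism f by split=> //; have := fc 1; rewrite !scale1r.
have fZ : scalable f.
  by move=> c x; rewrite -(mul1r x) scalerAl fM fc -scalerAl !mul1r.
pose F : {lrmorphism A -> B} :=
  HB.pack f (GRing.isZmodMorphism.Build _ _ f fB)
    (GRing.isMonoidMorphism.Build _ _ f f1)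
    (GRing.isScalable.Build _ _ _ _ f fZ).
by exists F.
Qed.

Definition ring_as_alg (k : fieldType) (R : comNzRingType)
  (h : {rmorphism k -> R}) : Type := R.

Section RingAsAlg.
Variables (k : fieldType) (R : comNzRingType) (h : {rmorphism k -> R}).
Notation B := (ring_as_alg h).
HB.instance Definition _ := GRing.ComNzRing.on B.
Definition ring_as_alg_scale (c : k) (x : B) : B := h c * (x : R).
Lemma ring_as_alg_scaleA a b v :
  ring_as_alg_scale a (ring_as_alg_scale b v) = ring_as_alg_scale (a * b) v.
Proof. by rewrite /ring_as_alg_scale mulrA -rmorphM. Qed.
Lemma ring_as_alg_scale1 : left_id 1 ring_as_alg_scale.
Proof. by move=> v; rewrite /ring_as_alg_scale rmorph1 mul1r. Qed.
Lemma ring_as_alg_scaleDr : right_distributive ring_as_alg_scale +%R.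
Proof. by move=> a u v; rewrite /ring_as_alg_scale mulrDr. Qed.
Lemma ring_as_alg_scaleDl v : {morph ring_as_alg_scale^~ v : a b / a + b}.
Proof. by move=> a b; rewrite /ring_as_alg_scale rmorphD mulrDl. Qed.
HB.instance Definition _ := GRing.Zmodule_isLmodule.Build k B
  ring_as_alg_scaleA ring_as_alg_scale1 ring_as_alg_scaleDr
  ring_as_alg_scaleDl.
Lemma ring_as_alg_scaleAl (c : k) (x y : B) : c *: (x * y) = c *: x * y.
Proof. exact: (mulrA (h c) x y). Qed.
HB.instance Definition _ :=
  GRing.Lmodule_isLalgebra.Build k B ring_as_alg_scaleAl.
HB.instance Definition _ := GRing.Lalgebra_isComAlgebra.Build k B.
End RingAsAlg.

Lemma quotient_alg_ex (k : fieldType) (R : comNzRingType)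
    (h : {rmorphism k -> R}) (I : R -> Prop) :
    I 0 -> ~ I 1 -> (forall a b, I a -> I b -> I (a + b)) ->
    (forall a b, I b -> I (a * b)) ->
  exists (B : comAlgType k) (p : {rmorphism R -> B}),
    [/\ forall b, exists a, p a = b, forall a, p a = 0 <-> I a &
        forall c, p (h c) = c%:A].
Proof.
move=> I0 I1 ID IM; pose S : {pred R} := fun a => `[< I a >].
have SI : idealr_closed S.
  split; [exact/asboolP|by apply/negP => /asboolP|].
  by move=> a b c /asboolP Ib /asboolP Ic; apply/asboolP/ID => //; apply: IM.
pose S' : idealr R := HB.pack S (isIdealr.Build R S SI).
pose p : {rmorphism R -> {ideal_quot S'}} := \pi_({ideal_quot S'}).
pose h' : {rmorphism k -> {ideal_quot S'}} := p \o h.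
exists (ring_as_alg h' : comAlgType k), p; split.
- by move=> b; exists (repr (b : {ideal_quot S'})); apply: reprK.
- move=> a; rewrite (_ : I a <-> a \in S'); last first.
    by split=> [/asboolP|/asboolP].
  have := Quotient.idealrBE S' a 0; rewrite subr0 => ->.
  rewrite -[X in _ = X](rmorph0 p).
  by split=> [->|/eqP].
- by move=> c; rewrite -[LHS](mulr1 (p (h c))).
Qed.

(* The ideal generated by S is the whole ring. *)
Definition unit_ideal (R : comNzRingType) (S : R -> Prop) : Prop :=
  exists (m : nat) (a b : 'I_m -> R),
    (forall i, S (a i)) /\ \sum_(i < m) b i * a i = 1.

(* phi identifies B with A[1/f]. *)
Definition is_localization (k : fieldType) (A B : comAlgType k) (f : A)
    (phi : {lrmorphism A -> B}) : Prop :=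
  [/\ exists u, phi f * u = 1,
      forall b, exists a n, b * phi f ^+ n = phi a &
      forall a, phi a = 0 -> exists n, f ^+ n * a = 0].

Lemma unit_ideal_radical (R : comNzRingType) (S J : R -> Prop) :
    unit_ideal S -> J 0 -> (forall a b, J a -> J b -> J (a + b)) ->
    (forall a b, J b -> J (a * b)) ->
    (forall a, S a -> exists n, J (a ^+ n)) ->
  J 1.
Proof.
move=> [m [a [b [Sa sum1]]]] J0 JD JM SJ.
suff [n] : exists n, J (1 ^+ n) by rewrite expr1n.
rewrite -sum1; elim/big_rec: _ => [|i c _ [n Jn]].
  by exists 1%N; rewrite expr1.
have [p Jp] := SJ _ (Sa i); exists (p + n)%N.
rewrite exprDn; elim/big_rec: _ => // j d _ Jd; apply: JD => //.
rewrite -mulr_natl; apply: (JM); move: (nat_of_ord j) => {}j.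
have [le_nj|lt_jn] := leqP n j.
  by rewrite -(subnK le_nj) exprD mulrA; apply: JM.
rewrite mulrC exprMn mulrA.
have -> : (p + n - j = (n - j) + p)%N by rewrite -addnBA 1?ltnW // addnC.
by rewrite [X in _ * X]exprD mulrA; apply: JM.
Qed.

Section Localization.
Variable k : fieldType.
Implicit Types A B C : comAlgType k.

Lemma localization_ex A (f : A) : (forall n, f ^+ n != 0) ->
  exists (B : comAlgType k) (phi : {lrmorphism A -> B}), is_localization f phi.
Proof.
move=> fn0.
pose h : {rmorphism k -> {poly A}} := polyC \o in_alg A.
pose I (p : {poly A}) := exists q, p = q * (f%:P * 'X - 1).
have IP c : I c%:P -> exists n, f ^+ n * c = 0.
  move=> [q cE]; have qE i : q`_i = - (f ^+ i * c).
    elim: i => [|i IHi].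
      have /(congr1 (fun p : {poly A} => p`_0)) := cE.
      rewrite mulrBr mulr1 mulrA coefB coefMX coefC /= => ->.
      by rewrite sub0r expr0 mul1r opprK.
    have /(congr1 (fun p : {poly A} => p`_i.+1)) := cE.
    rewrite mulrBr mulr1 mulrA coefB coefMX coefC coefMC /= => /eqP.
    by rewrite eq_sym subr_eq0 IHi => /eqP <-; rewrite exprSr mulNr mulrAC.
  by exists (size q); apply/eqP; rewrite -oppr_eq0 -qE nth_default.
have [||||B [p [p_surj p_ker p_alg]]] := @quotient_alg_ex k _ h I.
- by exists 0; rewrite mul0r.
- by case/IP => n /eqP; rewrite mulr1 (negPf (fn0 n)).
- by move=> a b [q ->] [r ->]; exists (q + r); rewrite mulrDl.
- by move=> a b [q ->]; exists (a * q); rewrite mulrA.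
have [||c|phi phiE] := @lrmorphism_ex k A B (fun a => p a%:P).
- by move=> x y; rewrite polyCD rmorphD.
- by move=> x y; rewrite polyCM rmorphM.
- exact: p_alg.
exists B, phi.
have fx : phi f * p 'X = 1.
  rewrite phiE -rmorphM; apply/eqP; rewrite -subr_eq0 -(rmorph1 p) -rmorphB.
  by apply/eqP/p_ker; exists 1; rewrite mul1r.
split; first by exists (p 'X).
- move=> b; have [q <-] := p_surj b; elim/poly_ind: q => [|q c [a [n qE]]].
    by exists 0, 0%N; rewrite !rmorph0 mul0r.
  exists (a + c * f ^+ n.+1), n.+1.
  rewrite rmorphD mulrDl rmorphM exprSr mulrACA qE [p 'X * _]mulrC fx.
  by rewrite mulr1 rmorphD -exprSr rmorphM rmorphXn /= [phi c]phiE.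
- by move=> a; rewrite phiE => /p_ker/IP.
Qed.

Lemma localization_lift A B C (f : A) (phi : {lrmorphism A -> B})
    (psi : {lrmorphism A -> C}) u :
    is_localization f phi -> psi f * u = 1 ->
  exists alpha : {lrmorphism B -> C}, alpha \o phi =1 psi.
Proof.
move=> [_ phi_frac phi_ker] fu.
pose G b c := exists a n, b * phi f ^+ n = phi a /\ c * psi f ^+ n = psi a.
have canc n x y : x * psi f ^+ n = y * psi f ^+ n -> x = y.
  move=> /(congr1 (fun z => z * u ^+ n)).
  by rewrite -!mulrA -exprMn fu expr1n !mulr1.
have Guniq b c c' : G b c -> G b c' -> c = c'.
  move=> [a [n [bE cE]]] [a' [n' [bE' cE']]].
  have [|r rE] := phi_ker (a * f ^+ n' - a' * f ^+ n).
    rewrite rmorphB !rmorphM !rmorphXn /= -bE -bE' -!mulrA -!exprD addnC.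
    exact: subrr.
  apply: (canc (n + n')%N); rewrite {2}addnC !exprD !mulrA cE cE'.
  apply: (canc r); apply/eqP; rewrite -subr_eq0 -mulrBl mulrC.
  have /eqP := congr1 psi rE.
  by rewrite rmorphM rmorphXn rmorphB !rmorphM !rmorphXn rmorph0.
have /choice[g gP] b : exists c, G b c.
  have [a [n bE]] := phi_frac b; exists (psi a * u ^+ n), a, n.
  by rewrite -mulrA -exprMn [u * _]mulrC fu expr1n mulr1.
have [||c|alpha alphaE] := @lrmorphism_ex k B C g.
- move=> x y; apply: Guniq (gP _) _.
  have [a [n [xE gxE]]] := gP x; have [b [m [yE gyE]]] := gP y.
  exists (a * f ^+ m + b * f ^+ n), (n + m)%N.
  rewrite !rmorphD !rmorphM !rmorphXn /= -xE -yE -gxE -gyE !mulrDl !exprD.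
  by split; congr (_ + _); rewrite -!mulrA // [_ ^+ m * _]mulrC.
- move=> x y; apply: Guniq (gP _) _.
  have [a [n [xE gxE]]] := gP x; have [b [m [yE gyE]]] := gP y.
  exists (a * b), (n + m)%N.
  by rewrite !rmorphM /= -xE -yE -gxE -gyE !exprD; split; apply: mulrACA.
- apply: Guniq (gP _) _; exists c%:A, 0%N.
  by rewrite !expr0 !mulr1 !linearZ /= !rmorph1.
exists alpha => a /=; rewrite alphaE; apply: Guniq (gP _) _.
by exists a, 0%N; rewrite !expr0 !mulr1.
Qed.

Section Gluing.
Variables (A : comAlgType k) (m : nat) (f : 'I_m -> A).
Variables (B : 'I_m -> comAlgType k) (phi : forall i, {lrmorphism A -> B i}).
Hypothesis f1 : unit_ideal (fun a => exists i, a = f i).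
Hypothesis phi_loc : forall i, is_localization (f i) (phi i).

Lemma localization_inj a b : (forall i, phi i a = phi i b) -> a = b.
Proof.
move=> ab; apply/eqP; rewrite -subr_eq0; apply/eqP; rewrite -[LHS]mul1r.
apply: (unit_ideal_radical (J := fun c => c * (a - b) = 0) f1).
- exact: mul0r.
- by move=> x y xE yE; rewrite mulrDl xE yE addr0.
- by move=> x y yE; rewrite -mulrA yE mulr0.
- move=> _ [i ->]; have [_ _] := phi_loc i; apply.
  by rewrite rmorphB /= ab subrr.
Qed.

Lemma localization_glue (x : forall i, B i) :
    (forall i j C (al : {lrmorphism B i -> C}) (be : {lrmorphism B j -> C}),
      al \o phi i =1 be \o phi j -> al (x i) = be (x j)) ->
  exists a, forall i, phi i a = x i.
Proof.
move=> x_compat.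
have /choice[an anP] i : exists an : A * nat,
    x i * phi i (f i) ^+ an.2 = phi i an.1.
  by have [_ /(_ (x i))[a [n E]] _] := phi_loc i; exists (a, n).
pose a i := (an i).1; pose n i := (an i).2.
have /choice[M MP] (ij : 'I_m * 'I_m) : exists r : nat,
    (f ij.1 * f ij.2) ^+ r *
    (a ij.1 * f ij.2 ^+ n ij.2 - a ij.2 * f ij.1 ^+ n ij.1) = 0.
  case: ij => i j /=.
  have [[r rE]|fij] := pselect (exists r, (f i * f j) ^+ r = 0).
    by exists r; rewrite rE mul0r.
  have [|C [psi psi_loc]] := @localization_ex A (f i * f j).
    by move=> r; apply/eqP => rE; apply: fij; exists r.
  have [[u fu] _ psi_ker] := psi_loc; apply: psi_ker.
  rewrite rmorphM in fu.
  have [al alE] : exists al : {lrmorphism B i -> C}, al \o phi i =1 psi.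
    by apply: (localization_lift (phi_loc i) (u := psi (f j) * u)); rewrite mulrA.
  have [be beE] : exists be : {lrmorphism B j -> C}, be \o phi j =1 psi.
    apply: (localization_lift (phi_loc j) (u := psi (f i) * u)).
    by rewrite mulrCA mulrA.
  have xij : al (x i) = be (x j).
    by apply: x_compat => c; rewrite alE beE.
  have al_i c : al (phi i c) = psi c := alE c.
  have be_j c : be (phi j c) = psi c := beE c.
  have psi_ai : psi (a i) = al (x i) * psi (f i) ^+ n i.
    by rewrite -al_i -anP rmorphM rmorphXn /= al_i.
  have psi_aj : psi (a j) = al (x i) * psi (f j) ^+ n j.
    by rewrite -be_j -anP rmorphM rmorphXn /= be_j xij.
  rewrite rmorphB !rmorphM !rmorphXn /= psi_ai psi_aj.
  by apply/eqP; rewrite subr_eq0 mulrAC.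
pose r := (\sum_ij M ij)%N; pose F i := f i ^+ (n i + r).
pose a' i := a i * f i ^+ r.
have aF i j : a' i * F j = a' j * F i.
  apply/eqP; rewrite -subr_eq0; apply/eqP.
  have /= := MP (i, j); have : (M (i, j) <= r)%N.
    by rewrite /r (bigD1 (i, j)) //= leq_addr.
  move=> /subnK rE /(congr1 (fun z => (f i * f j) ^+ (r - M (i, j)) * z)).
  rewrite mulr0 mulrA -exprD rE => <-.
  rewrite /a' /F !exprD exprMn.
  move: (f i ^+ r) (f j ^+ r) (f i ^+ n i) (f j ^+ n j) => x1 x2 x3 x4.
  by ring.
have [b sum1] : exists b : 'I_m -> A, 1 = \sum_i b i * F i.
  apply: (unit_ideal_radical (J := fun c => exists b : 'I_m -> A, c = \sum_i b i * F i) f1).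
  - by exists (fun=> 0); rewrite big1 // => i _; rewrite mul0r.
  - move=> c d [b ->] [b' ->]; exists (fun i => b i + b' i).
    by rewrite -big_split /=; apply: eq_bigr => i _; rewrite mulrDl.
  - move=> c d [b ->]; exists (fun i => c * b i); rewrite mulr_sumr.
    by apply: eq_bigr => i _; rewrite mulrA.
  - move=> _ [i ->]; exists (n i + r)%N, (fun j => (j == i)%:R).
    rewrite (bigD1 i) //= eqxx mul1r big1 ?addr0 // => j /negPf ->.
    by rewrite mul0r.
exists (\sum_j b j * a' j) => i.
have [[u fu] _ _] := phi_loc i.
have Fu : phi i (F i) * u ^+ (n i + r) = 1.
  by rewrite rmorphXn -exprMn fu expr1n.
have aE : (\sum_j b j * a' j) * F i = a' i.
  rewrite -[RHS]mul1r sum1 !mulr_suml; apply: eq_bigr => j _.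
  by rewrite -mulrA aF mulrA mulrAC.
rewrite -[LHS]mulr1 -Fu mulrA -rmorphM aE -[RHS]mulr1 -Fu mulrA.
congr (_ * _); rewrite /a' /F /a /n exprD !rmorphM /= -anP !rmorphXn.
by rewrite mulrA.
Qed.
End Gluing.
End Localization.

(* The two laws quantify over the composite up to pointwise equality, so that   *)
(* fmap only depends on the underlying function of a morphism of algebras.    *)
Record kfunctor (k : fieldType) := KFunctor {
  points :> comAlgType k -> Type;
  fmap : forall A B : comAlgType k,
    {lrmorphism A -> B} -> points A -> points B;
  fmap_id : forall (A : comAlgType k) (f : {lrmorphism A -> A}) x,
    f =1 id -> fmap f x = x;
  fmap_comp : forall (A B C : comAlgType k) (f : {lrmorphism A -> B})
    (g : {lrmorphism B -> C}) (h : {lrmorphism A -> C}) x,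
    h =1 g \o f -> fmap h x = fmap g (fmap f x)
}.
Arguments fmap {k} X {A B} f x : rename.

Definition kiso (k : fieldType) (X Y : kfunctor k) : Prop :=
  exists (u : forall A, X A -> Y A) (v : forall A, Y A -> X A),
    [/\ forall (A B : comAlgType k) (f : {lrmorphism A -> B}) x,
          u B (fmap X f x) = fmap Y f (u A x),
        forall A, cancel (u A) (v A) & forall A, cancel (v A) (u A)].

Record subfunctor (k : fieldType) (X : kfunctor k) := Subfunctor {
  in_sub :> forall A, X A -> Prop;
  in_sub_fmap : forall (A B : comAlgType k) (f : {lrmorphism A -> B}) x,
    in_sub x -> in_sub (fmap X f x)
}.

Section SubKFunctor.
Variables (k : fieldType) (X : kfunctor k) (Z : subfunctor X).
Definition sub_points (A : comAlgType k) : Type := {x : X A | Z A x}.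
Definition sub_fmap (A B : comAlgType k) (f : {lrmorphism A -> B})
    (x : sub_points A) : sub_points B :=
  exist _ (fmap X f (sval x)) (in_sub_fmap f (svalP x)).
Lemma sub_fmap_id (A : comAlgType k) (f : {lrmorphism A -> A}) x : f =1 id -> sub_fmap f x = x.
Proof. by case: x => x Zx fid; apply/eq_exist/fmap_id. Qed.
Lemma sub_fmap_comp (A B C : comAlgType k) (f : {lrmorphism A -> B}) (g : {lrmorphism B -> C})
    (h : {lrmorphism A -> C}) x :
  h =1 g \o f -> sub_fmap h x = sub_fmap g (sub_fmap f x).
Proof. by case: x => x Zx hE; apply/eq_exist/fmap_comp. Qed.
Definition sub_kfunctor : kfunctor k := KFunctor sub_fmap_id sub_fmap_comp.
End SubKFunctor.

Section ProdKFunctor.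
Variables (k : fieldType) (X Y : kfunctor k).
Definition prod_points (A : comAlgType k) : Type := (X A * Y A)%type.
Definition prod_fmap (A B : comAlgType k) (f : {lrmorphism A -> B})
    (z : prod_points A) : prod_points B :=
  (fmap X f z.1, fmap Y f z.2).
Lemma prod_fmap_id (A : comAlgType k) (f : {lrmorphism A -> A}) z : f =1 id -> prod_fmap f z = z.
Proof. by case: z => x y fid; congr (_, _); apply: fmap_id. Qed.
Lemma prod_fmap_comp (A B C : comAlgType k) (f : {lrmorphism A -> B}) (g : {lrmorphism B -> C})
    (h : {lrmorphism A -> C}) z :
  h =1 g \o f -> prod_fmap h z = prod_fmap g (prod_fmap f z).
Proof. by case: z => x y hE; congr (_, _); apply: fmap_comp. Qed.
Definition prod_kfunctor : kfunctor k := KFunctor prod_fmap_id prod_fmap_comp.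
End ProdKFunctor.

Definition mpoly_eval (k : fieldType) (A : comAlgType k) (n : nat)
  (v : 'I_n -> A) (p : {mpoly k[n]}) : A := mmap (in_alg A) v p.

(* The closed subscheme of affine n-space defined by a set P of polynomials,   *)
(* i.e. the functor Hom(k[X_1..X_n]/(P), -).                                   *)
Section ZeroSet.
Variables (k : fieldType) (n : nat) (P : {mpoly k[n]} -> Prop).
Lemma mpoly_eval_fmap (A B : comAlgType k) (f : {lrmorphism A -> B})
    (v : 'I_n -> A) (p : {mpoly k[n]}) :
  f (mpoly_eval v p) = mpoly_eval (f \o v) p.
Proof.
rewrite /mpoly_eval /mmap raddf_sum; apply: eq_bigr => m _.
rewrite /= rmorphM /= linearZ /= rmorph1; congr (_ * _).
rewrite /mmap1 rmorph_prod; apply: eq_bigr => i _; exact: rmorphXn.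
Qed.
Definition zero_points (A : comAlgType k) : Type :=
  {v : 'I_n -> A | forall p, P p -> mpoly_eval v p = 0}.
Lemma zero_fmap_subproof (A B : comAlgType k) (f : {lrmorphism A -> B})
    (v : zero_points A) p : P p -> mpoly_eval (f \o sval v) p = 0.
Proof. by move=> Pp; rewrite -mpoly_eval_fmap (svalP v) // rmorph0. Qed.
Definition zero_fmap (A B : comAlgType k) (f : {lrmorphism A -> B})
    (v : zero_points A) : zero_points B :=
  exist _ (f \o sval v) (zero_fmap_subproof f v).
Lemma zero_fmap_id (A : comAlgType k) (f : {lrmorphism A -> A}) v : f =1 id -> zero_fmap f v = v.
Proof. by case: v => v Pv fid; apply/eq_exist/funext => i; apply: fid. Qed.
Lemma zero_fmap_comp (A B C : comAlgType k) (f : {lrmorphism A -> B}) (g : {lrmorphism B -> C})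
    (h : {lrmorphism A -> C}) v :
  h =1 g \o f -> zero_fmap h v = zero_fmap g (zero_fmap f v).
Proof. by case: v => v Pv hE; apply/eq_exist/funext => i; apply: hE. Qed.
Definition zero_kfunctor : kfunctor k := KFunctor zero_fmap_id zero_fmap_comp.
End ZeroSet.

Section Varieties.
Variable k : fieldType.
Implicit Types X Y : kfunctor k.

(* The pullback of Z along any x : Spec A -> X is the closed subscheme V(I). *)
Definition closed_sub X (Z : subfunctor X) : Prop :=
  forall (A : comAlgType k) (x : X A), exists I : A -> Prop,
    forall (B : comAlgType k) (f : {lrmorphism A -> B}),
      Z B (fmap X f x) <-> forall a, I a -> f a = 0.

(* The pullback of U along any x : Spec A -> X is the open subscheme Spec A \  *)
(* V(I): f : Spec B -> Spec A factors through it iff f(I)B = B.               *)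
Definition open_sub X (U : subfunctor X) : Prop :=
  forall (A : comAlgType k) (x : X A), exists I : A -> Prop,
    forall (B : comAlgType k) (f : {lrmorphism A -> B}),
      U B (fmap X f x) <-> unit_ideal (fun b => exists2 a, I a & b = f a).

(* Sheaf condition for the covers of Spec A by the Spec A[1/f_i]; sections x_i *)
(* and x_j agree on Spec A[1/(f_i f_j)], the fibre product over Spec A, iff    *)
(* they agree after any pair of maps to a common A-algebra C. The f_i are not  *)
(* nilpotent here (B i is nonzero), which is harmless: dropping the nilpotent  *)
(* members of a family generating the unit ideal leaves such a family.         *)
Definition zariski_local X : Prop :=
  forall (A : comAlgType k) (m : nat) (f : 'I_m -> A)
    (B : 'I_m -> comAlgType k) (phi : forall i, {lrmorphism A -> B i}),
    unit_ideal (fun a => exists i, a = f i) ->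
    (forall i, is_localization (f i) (phi i)) ->
  forall x : forall i, X (B i),
    (forall i j (C : comAlgType k)
        (g : {lrmorphism B i -> C}) (h : {lrmorphism B j -> C}),
      g \o phi i =1 h \o phi j -> fmap X g (x i) = fmap X h (x j)) ->
  exists! y : X A, forall i, fmap X (phi i) y = x i.

(* The diagonal X -> X x X is a closed immersion. *)
Definition separated X : Prop :=
  forall (A : comAlgType k) (x y : X A), exists I : A -> Prop,
    forall (B : comAlgType k) (f : {lrmorphism A -> B}),
      fmap X f x = fmap X f y <-> forall a, I a -> f a = 0.

(* X is the spectrum of a finitely generated k-algebra. *)
Definition affine_ft X : Prop :=
  exists (n : nat) (P : {mpoly k[n]} -> Prop), kiso X (zero_kfunctor P).

(* Open subfunctors cover a scheme iff they cover its points in every field. *)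
Definition covers X (m : nat) (U : 'I_m -> subfunctor X) : Prop :=
  forall K : comAlgType k, (forall a : K, a != 0 -> exists b, a * b = 1) ->
  forall x : X K, exists i, U i K x.

Definition is_variety X : Prop :=
  [/\ zariski_local X, separated X &
      exists (m : nat) (U : 'I_m -> subfunctor X),
        [/\ forall i, open_sub (U i),
            forall i, affine_ft (sub_kfunctor (U i)) & covers U]].

Lemma zero_kfunctor_variety n (P : {mpoly k[n]} -> Prop) :
  is_variety (zero_kfunctor P).
Proof.
split.
- move=> A m f B phi f1 phi_loc x x_compat.
  have /choice[y yP] (l : 'I_n) : exists a, forall i, phi i a = sval (x i) l.
    apply: (localization_glue f1 phi_loc) => i j C g h gh.
    by have /(congr1 (fun v => sval v l)) := x_compat i j C g h gh.
  have Py p : P p -> mpoly_eval y p = 0.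
    move=> Pp; apply: (localization_inj f1 phi_loc) => i.
    rewrite rmorph0 mpoly_eval_fmap -[RHS](svalP (x i) p Pp).
    by congr mpoly_eval; apply/funext => l; apply: yP.
  exists (exist _ y Py); split=> [i|[z Pz] zE].
    by case: (x i) (yP^~ i) => xi Pxi xiE; apply/eq_exist/funext => l; apply: xiE.
  apply/eq_exist/funext => l; apply: (localization_inj f1 phi_loc) => i.
  by rewrite yP -zE.
- move=> A [v Pv] [w Pw]; exists (fun a => exists l, a = v l - w l) => B f.
  split=> [/(congr1 sval) vw a [l ->]|vw].
    by apply/eqP; rewrite rmorphB subr_eq0; apply/eqP/(congr1 (fun u => u l) vw).
  apply/eq_exist/funext => l; apply/eqP; rewrite -subr_eq0 /= -rmorphB.
  by apply/eqP/vw; exists l.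
- pose U := @Subfunctor k (zero_kfunctor P) (fun _ _ => True) (fun _ _ _ _ _ => I).
  exists 1%N, (fun=> U); split=> [_|_|K _ x]; last by exists ord0.
    move=> A x; exists (fun a => a = 1) => B f; split=> // _.
    exists 1%N, (fun=> 1), (fun=> 1); split=> [_|]; last by rewrite big_ord1 mulr1.
    by exists 1; rewrite ?rmorph1.
  exists n, P, (fun A x => sval x), (fun A x => exist _ x I).
  by split=> // A [x []].
Qed.

Lemma prod_affine_ft X Y :
  affine_ft X -> affine_ft Y -> affine_ft (prod_kfunctor X Y).
Proof.
move=> [n [P [u [v [uN uK vK]]]]] [m [Q [u' [v' [uN' uK' vK']]]]].
pose lp (p : {mpoly k[n]}) : {mpoly k[n + m]} :=
  mmap (@mpolyC _ k) (fun i => 'X_(lshift m i)) p.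
pose lq (p : {mpoly k[m]}) : {mpoly k[n + m]} :=
  mmap (@mpolyC _ k) (fun i => 'X_(rshift n i)) p.
have lE l (h : 'I_l -> 'I_(n + m)) (A : comAlgType k) (w : 'I_(n + m) -> A) p :
    mpoly_eval w (mmap (@mpolyC _ k) (fun i => 'X_(h i)) p) =
    mpoly_eval (w \o h) p.
  pose ev := @mpoly_eval k A (n + m) w.
  have evD : {morph ev : x y / x + y} by move=> x y; apply: mmapD.
  have ev0 : ev 0 = 0 by apply: mmap0.
  have evM : {morph ev : x y / x * y} by move=> x y; apply: rmorphM.
  have ev1 : ev 1 = 1 by apply: rmorph1.
  have evX x c : ev (x ^+ c) = ev x ^+ c.
    by elim: c => [|c IHc]; rewrite ?expr0 // !exprS evM IHc.
  rewrite -/(ev _) [mmap _ _ p]/mmap (big_morph _ evD ev0) /mpoly_eval /mmap.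
  apply: eq_bigr => a _; rewrite evM [ev _%:MP]mmapC; congr (_ * _).
  rewrite /mmap1 (big_morph _ evM ev1); apply: eq_bigr => i _.
  by rewrite evX [ev _]mmapX mmap1U.
pose R (r : {mpoly k[n + m]}) :=
  (exists2 p, P p & r = lp p) \/ (exists2 q, Q q & r = lq q).
pose cat (A : comAlgType k) (x : 'I_n -> A) (y : 'I_m -> A) (i : 'I_(n + m)) :=
  match split i with inl a => x a | inr b => y b end.
have catl A x y : @cat A x y \o lshift m = x.
  apply/funext => i /=; rewrite /cat.
  by have := unsplitK (inl i : 'I_n + 'I_m) => /= ->.
have catr A x y : @cat A x y \o @rshift n m = y.
  apply/funext => i /=; rewrite /cat.
  by have := unsplitK (inr i : 'I_n + 'I_m) => /= ->.
have catR A (x : zero_kfunctor P A) (y : zero_kfunctor Q A) r :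
    R r -> mpoly_eval (cat A (sval x) (sval y)) r = 0.
  case=> [[p Pp ->]|[q Qq ->]].
    by rewrite lE catl (svalP x).
  by rewrite lE catr (svalP y).
have Rl A (w : zero_kfunctor R A) p : P p -> mpoly_eval (sval w \o lshift m) p = 0.
  by move=> Pp; rewrite -lE; apply: (svalP w); left; exists p.
have Rr A (w : zero_kfunctor R A) q : Q q -> mpoly_eval (sval w \o @rshift n m) q = 0.
  by move=> Qq; rewrite -lE; apply: (svalP w); right; exists q.
exists (n + m)%N, R.
exists (fun A (z : X A * Y A) => exist _ _ (catR A (u A z.1) (u' A z.2))).
exists (fun A w => (v A (exist _ _ (Rl A w)), v' A (exist _ _ (Rr A w)))).
split=> [A B f [x y]|A [x y]|A [w Rw]] /=.
- apply/eq_exist/funext => i; rewrite uN uN' /= /cat.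
  by case: split.
- congr (_, _).
    by rewrite -[RHS]uK; congr v; case: (u A x) (catR _ _ _) => x' Px' ?; apply/eq_exist/catl.
  by rewrite -[RHS]uK'; congr v'; case: (u' A y) (catR _ _ _) => y' Qy' ?; apply/eq_exist/catr.
- apply/eq_exist/funext => i; rewrite vK vK' /= /cat.
  by case: splitP => j ij; congr w; apply: val_inj; rewrite /= ij.
Qed.

Lemma prod_kfunctor_variety X Y :
  is_variety X -> is_variety Y -> is_variety (prod_kfunctor X Y).
Proof.
move=> [locX sepX [m [U [Uo Ua Uc]]]] [locY sepY [n [V [Vo Va Vc]]]].
split.
- move=> A l f B phi f1 phi_loc z z_compat.
  have [|x [xE xU]] := locX A l f B phi f1 phi_loc (fun i => (z i).1).
    by move=> i j C g h gh; have /(congr1 fst) := z_compat i j C g h gh.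
  have [|y [yE yU]] := locY A l f B phi f1 phi_loc (fun i => (z i).2).
    by move=> i j C g h gh; have /(congr1 snd) := z_compat i j C g h gh.
  exists (x, y); split=> [i|[x' y'] zE].
    by rewrite /= /prod_fmap /= xE yE; case: (z i).
  by congr (_, _); [apply: xU|apply: yU] => i; rewrite -zE.
- move=> A [x y] [x' y'].
  have [I IP] := sepX A x x'; have [J JP] := sepY A y y'.
  exists (fun a => I a \/ J a) => B f; split=> [[/IP fI /JP fJ] a []|fIJ].
  + exact: fI.
  + exact: fJ.
  + by congr (_, _); [apply/IP|apply/JP] => a ?; apply: fIJ; [left|right].
- pose W (ij : 'I_m * 'I_n) : subfunctor (prod_kfunctor X Y) :=
    @Subfunctor k (prod_kfunctor X Y)
      (fun A z => U ij.1 A z.1 /\ V ij.2 A z.2)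
      (fun A B f z Wz => conj (in_sub_fmap f Wz.1) (in_sub_fmap f Wz.2)).
  exists #|{: 'I_m * 'I_n}|, (W \o enum_val); split.
  + move=> c A [x y] /=; move: (enum_val c) => [i j] /=.
    have [I IP] := Uo i A x; have [J JP] := Vo j A y.
    exists (fun a => exists b c, [/\ I b, J c & a = b * c]) => B f.
    suff : U i B (fmap X f x) /\ V j B (fmap Y f y) <->
        unit_ideal (fun b => exists2 a, exists b c, [/\ I b, J c & a = b * c]
                                      & b = f a) by [].
    rewrite IP JP; split.
      move=> [[p [a [b [Ia ab1]]]] [q [a' [b' [Ja ab1']]]]].
      exists #|{: 'I_p * 'I_q}|,
        (fun s => a (enum_val s).1 * a' (enum_val s).2),
        (fun s => b (enum_val s).1 * b' (enum_val s).2).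
      split=> [s|].
        have [d Id ->] := Ia (enum_val s).1; have [e Je ->] := Ja (enum_val s).2.
        by exists (d * e); [exists d, e|rewrite rmorphM].
      rewrite -[RHS]mulr1 -[in X in _ = X * _]ab1 -ab1' big_distrlr /= pair_big /=.
      rewrite [RHS](reindex _ (onW_bij _ (enum_val_bij _))) /=.
      by apply: eq_big => [s|s _]; rewrite ?inE // mulrACA.
    move=> [p [a [b [IJa ab1]]]]; split.
      have /choice[d dP] s : exists d : A * B, I d.1 /\ a s = d.2 * f d.1.
        have [_ [d [e [Id Je ->]] ->]] := IJa s.
        by exists (d, f e); split; rewrite // rmorphM /= mulrC.
      exists p, (fun s => f (d s).1), (fun s => b s * (d s).2); split=> [s|].
        by exists (d s).1; first exact: (dP s).1.
      by rewrite -ab1; apply: eq_bigr => s _; rewrite (dP s).2 mulrA.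
    have /choice[d dP] s : exists d : A * B, J d.1 /\ a s = d.2 * f d.1.
      have [_ [d [e [Id Je ->]] ->]] := IJa s.
      by exists (e, f d); split; rewrite // rmorphM.
    exists p, (fun s => f (d s).1), (fun s => b s * (d s).2); split=> [s|].
      by exists (d s).1; first exact: (dP s).1.
    by rewrite -ab1; apply: eq_bigr => s _; rewrite (dP s).2 mulrA.
  + move=> c /=; move: (enum_val c) => [i j].
    have [l [Q [u [v [uN uK vK]]]]] := prod_affine_ft (Ua i) (Va j).
    pose s A (z : sub_kfunctor (W (i, j)) A) :
        prod_kfunctor (sub_kfunctor (U i)) (sub_kfunctor (V j)) A :=
      (exist _ (sval z).1 (svalP z).1, exist _ (sval z).2 (svalP z).2).
    pose t A (z : prod_kfunctor (sub_kfunctor (U i)) (sub_kfunctor (V j)) A) :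
        sub_kfunctor (W (i, j)) A :=
      exist _ (sval z.1, sval z.2) (conj (svalP z.1) (svalP z.2)).
    exists l, Q, (fun A => u A \o s A), (fun A => t A \o v A); split.
    * move=> A B f z; apply: etrans (uN _ _ f (s A z)); congr (u B (_, _)); exact: eq_exist.
    * by move=> A [[x y] [Ux Vy]]; rewrite /= uK; apply/eq_exist.
    * move=> A z; apply: etrans (vK A z); rewrite /=; congr (u A); case: (v A z) => [[x Ux] [y Vy]].
      by congr (_, _); apply/eq_exist.
  + move=> K fK [x y]; have [i Ux] := Uc K fK x; have [j Vy] := Vc K fK y.
    by exists (enum_rank (i, j)); rewrite /= enum_rankK.
Qed.

Record variety := Variety { variety_fun :> kfunctor k;
                            varietyP : is_variety variety_fun }.

End Varieties.

Section GrothendieckRing.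
Variable k : fieldType.

(* The open complement of Z: x : Spec B -> X misses Z iff no nonempty Spec C   *)
(* over Spec B lands in Z. For Z closed with pullback V(I) along x, this says  *)
(* that I is the unit ideal of B.                                              *)
Section Complement.
Variables (X : kfunctor k) (Z : subfunctor X).
Definition compl_pred (A : comAlgType k) (x : X A) : Prop :=
  forall (B : comAlgType k) (f : {lrmorphism A -> B}), ~ Z B (fmap X f x).
Lemma compl_fmap (A B : comAlgType k) (f : {lrmorphism A -> B}) x :
  compl_pred x -> compl_pred (fmap X f x).
Proof.
move=> Zx C g; rewrite -(@fmap_comp _ _ _ _ _ f g (g \o f)) //; exact: Zx.
Qed.
Definition compl_sub : subfunctor X := Subfunctor compl_fmap.
End Complement.

Definition prod_variety (X Y : variety k) : variety k :=
  Variety (prod_kfunctor_variety (varietyP X) (varietyP Y)).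
Definition affine_space (n : nat) : variety k :=
  Variety (@zero_kfunctor_variety k n (fun=> False)).

(* Formal Z-linear combinations of varieties; addition is concatenation. *)
Definition kform : Type := seq (int * variety k).

Definition kclass (X : variety k) : kform := [:: (1, X)].
Definition kscale (c : int) (s : kform) : kform :=
  [seq (c * a.1, a.2) | a <- s].
Definition kmul (s t : kform) : kform :=
  [seq (a.1 * b.1, prod_variety a.2 b.2) | a <- s, b <- t].
(* affine_space 0 is Spec k, the unit. *)
Definition kexp (s : kform) (i : nat) : kform :=
  iter i (kmul s) (kclass (affine_space 0)).
(* The value p(s) = \sum_i p_i s^i. *)
Definition keval (p : {poly int}) (s : kform) : kform :=
  flatten [seq kscale p`_i (kexp s i) | i <- iota 0 (size p)].

(* Equality in K(Var_k): formal combinations modulo the laws of the free        *)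
(* abelian group, isomorphism, and [X] = [Z] + [X \ Z] for Z closed in X. The  *)
(* subgroup of relations is an ideal for kmul, as Z x W is closed in X x W     *)
(* with complement (X \ Z) x W. A closed subscheme and an open subscheme of a  *)
(* variety are varieties, so ZP and UP always exist. The quotient is kept as a *)
(* relation: kform lives in a universe above that of the k-algebras it is      *)
(* built from, and cannot carry a mathcomp ring structure.                     *)
Inductive K0_eq : kform -> kform -> Prop :=
| K0_refl s : K0_eq s s
| K0_sym s t : K0_eq s t -> K0_eq t s
| K0_trans s t u : K0_eq s t -> K0_eq t u -> K0_eq s u
| K0_cat s s' t t' : K0_eq s s' -> K0_eq t t' -> K0_eq (s ++ t) (s' ++ t')
| K0_catC s t : K0_eq (s ++ t) (t ++ s)
| K0_zero (X : variety k) : K0_eq [:: (0, X)] [::]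
| K0_add (a b : int) (X : variety k) : K0_eq [:: (a, X); (b, X)] [:: (a + b, X)]
| K0_iso (X Y : variety k) : kiso X Y -> K0_eq (kclass X) (kclass Y)
| K0_scissor (X : variety k) (Z : subfunctor X)
    (ZP : is_variety (sub_kfunctor Z))
    (UP : is_variety (sub_kfunctor (compl_sub Z))) :
    closed_sub Z ->
    K0_eq (kclass X) (kclass (Variety ZP) ++ kclass (Variety UP)).

End GrothendieckRing.

Section ProjectiveSpace.
Variables (k : fieldType) (n : nat).

(* A-points of projective space: direct summands of rank 1 of A^(n+1), given as *)
(* images of idempotent matrices; the rank is 1 at every point of Spec A.      *)
Definition rank1_summand (A : comAlgType k) (L : 'rV[A]_n.+1 -> Prop) : Prop :=
  exists e : 'M[A]_n.+1,
    [/\ e *m e = e, forall v, L v <-> exists u : 'rV[A]_n.+1, v = u *m e &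
        forall (F : fieldType) (f : {rmorphism A -> F}),
          \rank (map_mx f e) = 1%N].

Definition proj_points (A : comAlgType k) : Type := {L | @rank1_summand A L}.

(* The B-submodule of B^(n+1) generated by the image of L. *)
Definition span_ext (A B : comAlgType k) (f : {lrmorphism A -> B})
    (L : 'rV[A]_n.+1 -> Prop) (w : 'rV[B]_n.+1) : Prop :=
  exists (m : nat) (b : 'rV[B]_m) (V : 'M[A]_(m, n.+1)),
    (forall i, L (row i V)) /\ w = b *m map_mx f V.

Lemma span_extE (A B : comAlgType k) (f : {lrmorphism A -> B}) L e :
  (forall v, L v <-> exists u : 'rV[A]_n.+1, v = u *m e) ->
  forall w, span_ext f L w <-> exists u : 'rV[B]_n.+1, w = u *m map_mx f e.
Proof.
move=> LE w; split=> [[m [b [V [LV ->]]]]|[u ->]].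
  have /choice[U UP] i : exists u : 'rV[A]_n.+1, row i V = u *m e by apply/LE.
  exists (b *m map_mx f (\matrix_i U i)); rewrite -mulmxA -map_mxM.
  congr (_ *m map_mx _ _); apply/row_matrixP => i.
  by rewrite row_mul rowK UP.
exists n.+1, u, e; split=> // i; apply/LE; exists (row i 1%:M).
by rewrite -row_mul mul1mx.
Qed.

Lemma span_ext_summand (A B : comAlgType k) (f : {lrmorphism A -> B}) L :
  rank1_summand L -> rank1_summand (span_ext f L).
Proof.
move=> [e [ee LE e1]]; exists (map_mx f e); split.
- by rewrite -map_mxM ee.
- exact: span_extE.
- by move=> F g; rewrite -map_mx_comp; apply: (e1 F (g \o f)).
Qed.

Definition proj_fmap (A B : comAlgType k) (f : {lrmorphism A -> B})
    (L : proj_points A) : proj_points B :=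
  exist _ (span_ext f (sval L)) (span_ext_summand f (svalP L)).

Lemma proj_fmap_id (A : comAlgType k) (f : {lrmorphism A -> A}) L :
  f =1 id -> proj_fmap f L = L.
Proof.
case: L => L LP fid; apply/eq_exist/funext => v; apply/propext.
have [e [_ LE _]] := LP; apply: iff_trans (span_extE f LE v) _.
by rewrite (_ : map_mx f e = e) ?LE //; apply/matrixP => i j; rewrite mxE fid.
Qed.

Lemma proj_fmap_comp (A B C : comAlgType k) (f : {lrmorphism A -> B})
    (g : {lrmorphism B -> C}) (h : {lrmorphism A -> C}) L :
  h =1 g \o f -> proj_fmap h L = proj_fmap g (proj_fmap f L).
Proof.
case: L => L LP hE; apply/eq_exist/funext => v; apply/propext.
have [e [_ LE _]] := LP; rewrite (span_extE h LE).
rewrite (span_extE g (span_extE f LE)).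
by rewrite (_ : map_mx h e = map_mx g (map_mx f e)) //;
  apply/matrixP => i j; rewrite !mxE hE.
Qed.

Definition proj_space : kfunctor k := KFunctor proj_fmap_id proj_fmap_comp.

(* The hyperplane l = 0 of projective space. *)
Definition hyperplane_pred (l : 'cV[k]_n.+1) (A : comAlgType k)
    (L : proj_space A) : Prop :=
  forall v, sval L v -> v *m map_mx (in_alg A) l = 0.

Lemma hyperplane_fmap l (A B : comAlgType k) (f : {lrmorphism A -> B})
    (L : proj_space A) :
  hyperplane_pred l L -> hyperplane_pred l (fmap proj_space f L).
Proof.
move=> lL _ [m [b [V [LV ->]]]].
have -> : map_mx (in_alg B) l = map_mx f (map_mx (in_alg A) l).
  by apply/matrixP => i j; rewrite !mxE /= linearZ /= rmorph1.
rewrite -mulmxA -map_mxM (_ : V *m _ = 0) ?map_mx0 ?mulmx0 //.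
by apply/row_matrixP => i; rewrite row_mul lL // row0.
Qed.

Definition hyperplane (l : 'cV[k]_n.+1) : subfunctor proj_space :=
  Subfunctor (@hyperplane_fmap l).

End ProjectiveSpace.

Definition central_hyperplane (k : fieldType) (n : nat) (l : 'cV[k]_n.+1) :
    {vspace 'rV[k]_n.+1} :=
  lker (linfun (mulmxr l : 'rV[k]_n.+1 -> 'rV[k]_1)).

(* Hyperplanes are given by equations; H_i and H_j are distinct iff the linear  *)
(* hyperplanes are.                                                           *)
Record arrangement (k : fieldType) (n d : nat) := Arrangement {
  arr_form :> 'I_d -> 'cV[k]_n.+1;
  arr_form_neq0 : forall i, arr_form i != 0;
  arr_distinct : injective (fun i => central_hyperplane (arr_form i))
}.

Section Arrangements.
Variables (k : fieldType) (n d : nat) (H : arrangement k n d).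

(* The union on points: it is not closed in the sense of closed_sub, but it has *)
(* the same points in every field as the closed union of the H_i, hence the    *)
(* same open complement.                                                       *)
Definition arr_union_pred (A : comAlgType k) (L : proj_space k n A) : Prop :=
  exists i, hyperplane (H i) A L.
Lemma arr_union_fmap (A B : comAlgType k) (f : {lrmorphism A -> B})
    (L : proj_space k n A) :
  arr_union_pred L -> arr_union_pred (fmap (proj_space k n) f L).
Proof. by case=> i HL; exists i; apply: in_sub_fmap. Qed.
Definition arr_union : subfunctor (proj_space k n) := Subfunctor arr_union_fmap.

Definition arr_compl : kfunctor k := sub_kfunctor (compl_sub arr_union).

End Arrangements.

Section Mobius.
Variables (T : eqType) (le : rel T) (s : seq T).

(* The Moebius function of the finite poset s, by recursion on y; m is fuel,    *)
(* and size s is enough (mobius_diag, mobius_sum).                             *)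
Fixpoint mobius_rec (m : nat) (x y : T) : int :=
  if m is m'.+1 then
    if x == y then 1
    else - \sum_(z <- s | [&& le x z, le z y & z != y]) mobius_rec m' x z
  else 0.
Definition mobius : T -> T -> int := mobius_rec (size s).

Hypotheses (le_refl : reflexive le) (le_anti : antisymmetric le)
  (le_trans : transitive le) (s_uniq : uniq s).

Lemma mobius_rec_stable m m' x y : y \in s ->
  (count (le^~ y) s <= m)%N -> (count (le^~ y) s <= m')%N ->
  mobius_rec m x y = mobius_rec m' x y.
Proof.
elim: m m' y => [|m IHm] [|m'] y ys.
- by [].
- by rewrite leqn0 -[_ == _]negbK -lt0n -has_count => /negP[]; apply/hasP; exists y.
- by move=> _; rewrite leqn0 -[_ == _]negbK -lt0n -has_count => /negP[]; apply/hasP; exists y.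
move=> ym ym' /=; case: eqP => // _; congr (- _).
rewrite big_seq_cond [RHS]big_seq_cond; apply: eq_bigr => z.
case/and4P => zs xz zy zNy.
have lt_zy : (count (le^~ z) s < count (le^~ y) s)%N.
  have := count_predUI (le^~ z) (pred1 y) s.
  rewrite (@eq_count _ (predI _ _) pred0) ?count_pred0 ?addn0; last first.
    move=> u /=; apply/negP => /andP[uz /eqP uy]; move: zNy.
    by rewrite (@le_anti z y) ?eqxx // zy -uy uz.
  move=> zyE; apply: (@leq_trans (count (predU (le^~ z) (pred1 y)) s)).
    by rewrite zyE -addn1 leq_add2l -has_count has_pred1.
  by apply: sub_count => u /= /orP[uz|/eqP -> //]; apply: le_trans uz zy.
by apply: IHm => //; rewrite -ltnS; apply: leq_trans lt_zy _.
Qed.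

Lemma mobius_diag x : x \in s -> mobius x x = 1.
Proof. by rewrite /mobius; case: (s) => //= *; rewrite eqxx. Qed.

Lemma mobius_sum x y : x \in s -> y \in s -> le x y -> x != y ->
  \sum_(z <- s | le x z && le z y) mobius x z = 0.
Proof.
move=> xs ys xy xNy; rewrite big_mkcond (bigD1_seq y) //= xy le_refl -big_mkcondr /=.
rewrite {1}/mobius (@mobius_rec_stable _ (size s).+1) ?count_size //; last first.
  exact: leq_trans (count_size _ _) _.
rewrite /= (negPf xNy); apply/eqP; rewrite addrC subr_eq0; apply/eqP.
by apply: eq_bigl => z; rewrite andbC andbA.
Qed.
End Mobius.

Section CharacteristicPolynomial.
Variables (k : fieldType) (n d : nat) (H : arrangement k n d).

Definition arr_lattice : seq {vspace 'rV[k]_n.+1} :=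
  undup [seq (\bigcap_(i in J) central_hyperplane (H i))%VS | J : {set 'I_d}].

(* Reverse inclusion. *)
Definition arr_le (y x : {vspace 'rV[k]_n.+1}) : bool := (x <= y)%VS.

Definition arr_mobius : {vspace 'rV[k]_n.+1} -> {vspace 'rV[k]_n.+1} -> int :=
  mobius arr_le arr_lattice.

Definition arr_char_poly : {poly int} :=
  \sum_(x <- arr_lattice) arr_mobius fullv x *: 'X^(\dim x).

(* Exact division, see arr_char_polyE. *)
Definition reduced_char_poly : {poly int} := arr_char_poly %/ ('X - 1).

Lemma arr_le_refl : reflexive arr_le.
Proof. exact: subvv. Qed.
Lemma arr_le_anti : antisymmetric arr_le.
Proof. by move=> x y xy; apply/eqP; rewrite eqEsubv andbC. Qed.
Lemma arr_le_trans : transitive arr_le.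
Proof. by move=> x y z xy yz; apply: subv_trans yz xy. Qed.

Lemma arr_mobius_diag x : x \in arr_lattice -> arr_mobius x x = 1.
Proof. exact: mobius_diag. Qed.

Lemma arr_mobius_sum x y : x \in arr_lattice -> y \in arr_lattice ->
  arr_le x y -> x != y ->
  \sum_(z <- arr_lattice | arr_le x z && arr_le z y) arr_mobius x z = 0.
Proof.
exact: (mobius_sum arr_le_refl arr_le_anti arr_le_trans (undup_uniq _)).
Qed.

Lemma arr_latticeP x : reflect
  (exists J : {set 'I_d}, x = (\bigcap_(i in J) central_hyperplane (H i))%VS)
  (x \in arr_lattice).
Proof.
rewrite mem_undup; apply: (iffP mapP) => [[J _ ->]|[J ->]]; exists J => //.
by rewrite mem_enum.
Qed.

Lemma central_hyperplane_neqT i : central_hyperplane (H i) != fullv.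
Proof.
apply: contraNneq (arr_form_neq0 H i) => HiT; apply/eqP/row_matrixP => j.
have : delta_mx 0 j \in central_hyperplane (H i) by rewrite HiT memvf.
by rewrite memv_ker lfunE /= -rowE row0 => /eqP.
Qed.

Lemma arr_char_poly1 : (0 < d)%N -> arr_char_poly.[1] = 0.
Proof.
move=> d0; pose w := (\bigcap_(i in [set: 'I_d]) central_hyperplane (H i))%VS.
have w_sub i : (w <= central_hyperplane (H i))%VS.
  by rewrite /w (bigD1 i) ?inE //= capvSl.
have wNT : fullv != w.
  apply: contraNneq (central_hyperplane_neqT (Ordinal d0)) => wE.
  by rewrite eqEsubv subvf wE w_sub.
rewrite /arr_char_poly horner_sum.
apply: etrans (@arr_mobius_sum fullv w _ _ _ _) => //; last exact: subvf.
- rewrite /arr_le big_seq [RHS]big_seq_cond; apply: eq_big => x.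
    rewrite subvf /=; case: arr_latticeP => //= -[J ->].
    by apply/esym/subv_bigcapP => i _; apply: w_sub.
  by move=> _; rewrite hornerZ hornerXn expr1n mulr1.
- by apply/arr_latticeP; exists set0; rewrite big_set0.
- by apply/arr_latticeP; exists setT.
Qed.

Lemma arr_char_polyE : (0 < d)%N ->
  arr_char_poly = reduced_char_poly * ('X - 1).
Proof.
move=> d0; rewrite /reduced_char_poly -polyC1.
rewrite Pdiv.IdomainUnit.divpK ?lead_coefXsubC ?unitr1 //.
by rewrite Pdiv.Idomain.dvdp_XsubCl; apply/rootP/arr_char_poly1.
Qed.
End CharacteristicPolynomial.

(* Main.v *)
Require Import Defs.
From HB Require Import structures.
From mathcomp Require Import all_boot all_order all_algebra.
From mathcomp Require classical_sets.
From mathcomp Require Import boolp mpoly ring.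

Set Implicit Arguments.
Unset Strict Implicit.
Unset Printing Implicit Defensive.

Import GRing.Theory.
Local Open Scope ring_scope.

(** As there is at least one hyperplane H_0, the complement of the arrangement
    lies in the affine chart l_0 = 1 of projective space: it is the affine
    scheme of vectors v with l_0(v) = 1 and all l_i(v) invertible
    ([arr_compl_locus]).  A point L of projective space in the complement
    corresponds to the unique v in L with l_0(v) = 1.  Such a v exists because
    an ideal that no nonzero algebra kills is the unit ideal; it spans L
    because the projector onto a complement of A v in L vanishes at every
    field, and an idempotent matrix with this property is zero.

    In the chart the class is computed by deletion and restriction.  For
    polynomial equations P and a polynomial q to be inverted, the scissor
    relation reads [P, q] = [l :: P, q] + [P, l q] ([locus_scissor]).  Using it
    once for each hyperplane expresses the class through the affine subspaces
    x \cap {l_0 = 1}, for x an intersection of the linear hyperplanes; such a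
    subspace is empty if x lies in H_0, and an affine space of dimension
    dim x - 1 otherwise ([form_locus_class]).

    On the combinatorial side the same recursion, started with the function
    x |-> t^(dim x) on subspaces, yields the characteristic polynomial: this is
    Whitney's theorem ([whitney]), a form of Moebius inversion.  Started with
    the polynomials of the affine subspaces x \cap {l_0 = 1}, it yields the
    quotient by t - 1.  Indeed t^(dim x) - t^(dim (x \cap H_0)) is t - 1 times
    the polynomial of x \cap {l_0 = 1} ([chart_polyE]), so multiplication by
    t - 1 turns the second recursion into the first with H_0 as one more
    hyperplane ([del_restr_chart]).  No division takes place in the Grothendieck
    ring. *)

(** * Isomorphisms of k-functors *)

Section Isomorphisms.
Variable k : fieldType.
Implicit Types X Y Z : kfunctor k.

Lemma kiso_refl X : kiso X X.
Proof. by exists (fun A => id), (fun A => id). Qed.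

Lemma kiso_sym X Y : kiso X Y -> kiso Y X.
Proof.
move=> [u [v [uN uK vK]]]; exists v, u; split=> // A B f y.
by rewrite -[in LHS](vK A y) -uN uK.
Qed.

Lemma kiso_trans X Y Z : kiso X Y -> kiso Y Z -> kiso X Z.
Proof.
move=> [u [v [uN uK vK]]] [u' [v' [uN' uK' vK']]].
exists (fun A => u' A \o u A), (fun A => v A \o v' A); split=> [A B f x|A|A].
- by rewrite /= uN uN'.
- by move=> x /=; rewrite ?uK' ?uK ?vK ?vK'.
- by move=> x /=; rewrite ?uK' ?uK ?vK ?vK'.
Qed.

(** The inverse of a pointwise bijective natural map is automatically natural,
    so it may be obtained by choice. *)
Lemma kiso_bij X Y (u : forall A, X A -> Y A) :
    (forall (A B : comAlgType k) (f : {lrmorphism A -> B}) x,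
      u B (fmap X f x) = fmap Y f (u A x)) ->
    (forall A, injective (u A)) -> (forall A y, exists x, u A x = y) ->
  kiso X Y.
Proof.
move=> uN u_inj u_surj; pose v A y := sval (cid (u_surj A y)).
have vK A : cancel (v A) (u A) by move=> y; apply: (svalP (cid (u_surj A y))).
by exists u, v; split=> // A x; apply: u_inj; rewrite vK.
Qed.

Lemma affine_ft_iso X Y : kiso X Y -> affine_ft Y -> affine_ft X.
Proof. by move=> XY [n [P YP]]; exists n, P; apply: kiso_trans YP. Qed.

Lemma kiso_prod X X' Y Y' :
  kiso X X' -> kiso Y Y' -> kiso (prod_kfunctor X Y) (prod_kfunctor X' Y').
Proof.
move=> [u [v [uN uK vK]]] [u' [v' [uN' uK' vK']]].
exists (fun A (z : prod_kfunctor X Y A) => (u A z.1, u' A z.2)).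
exists (fun A (z : prod_kfunctor X' Y' A) => (v A z.1, v' A z.2)).
split=> [A B f [x y]|A [x y]|A [x y]] /=; first by rewrite uN uN'.
  by rewrite uK uK'.
by rewrite vK vK'.
Qed.

(** The sheaf condition and separatedness are transported from the zero locus
    along the isomorphism; the cover consists of X alone, as the open
    subscheme on which the ideal generated by 1 is the unit ideal. *)
Lemma affine_variety X : affine_ft X -> is_variety X.
Proof.
move=> Xaff; have [n [P [u [v [uN uK vK]]]]] := Xaff.
have [locP sepP _] := zero_kfunctor_variety P.
have vN (A B : comAlgType k) (f : {lrmorphism A -> B}) y :
    v B (fmap _ f y) = fmap X f (v A y).
  by rewrite -[in LHS](vK A y) -uN uK.
split.
- move=> A m f B phi f1 phi_loc x x_compat.
  have [|y [yE yU]] := locP A m f B phi f1 phi_loc (fun i => u _ (x i)).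
    by move=> i j C g h gh; rewrite -!uN (x_compat i j C g h gh).
  exists (v A y); split=> [i|z zE]; first by rewrite -vN yE uK.
  by rewrite (yU (u A z)) ?uK // => i; rewrite -uN zE.
- move=> A x y; have [I IP] := sepP A (u A x) (u A y).
  exists I => B f; rewrite -IP -!uN.
  by split=> [->|/(congr1 (v B))] //; rewrite !uK.
- pose U := @Subfunctor k X (fun _ _ => True) (fun _ _ _ _ _ => Logic.I).
  exists 1%N, (fun=> U); split=> [_|_|K _ x]; last by exists ord0.
    move=> A x; exists (fun a => a = 1) => B f; split=> // _.
    exists 1%N, (fun=> 1), (fun=> 1); split; last by rewrite big_ord1 mulr1.
    by exists 1; rewrite ?rmorph1.
  apply: affine_ft_iso Xaff.
  exists (fun A => sval), (fun A x => exist _ x Logic.I).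
  by split=> // A [x []].
Qed.

End Isomorphisms.

(** * Quotients and residue fields *)

Section Quotients.

Definition is_ideal (A : comNzRingType) (I : A -> Prop) : Prop :=
  [/\ I 0, forall a b, I a -> I b -> I (a + b) & forall a b, I b -> I (a * b)].

Lemma principal_ideal (A : comNzRingType) (a : A) :
  is_ideal (fun b => exists c, b = c * a).
Proof.
split=> [|x y [b ->] [c ->]|x y [b ->]]; first by exists 0; rewrite mul0r.
  by exists (b + c); rewrite mulrDl.
by exists (x * b); rewrite mulrA.
Qed.

(** A proper ideal is killed by the quotient by itself, which is a nonzero
    algebra. *)
Lemma ideal_full (k : fieldType) (A : comAlgType k) (I : A -> Prop) : is_ideal I ->
    (forall (B : comAlgType k) (f : {lrmorphism A -> B}),
      ~ forall a, I a -> f a = 0) ->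
  I 1.
Proof.
move=> [I0 ID IM] Inq; apply: contrapT => I1.
have [B [p [_ p_ker p_alg]]] :=
  @quotient_alg_ex k A (in_alg A) I I0 I1 ID IM.
have [|||f fE] := @lrmorphism_ex k A B p.
- exact: rmorphD.
- exact: rmorphM.
- exact: p_alg.
by apply: (Inq B f) => a Ia; rewrite fE; apply/p_ker.
Qed.

Lemma unit_of_nonzero (k : fieldType) (A : comAlgType k) (a : A) :
    (forall (B : comAlgType k) (f : {lrmorphism A -> B}), f a <> 0) ->
  exists u, a * u = 1.
Proof.
move=> fa; have [B f fI|u uE] := ideal_full (principal_ideal a).
  by apply: (fa B f); apply: fI; exists 1; rewrite mul1r.
by exists u; rewrite mulrC.
Qed.

Lemma unit_nonzero (k : fieldType) (A B : comAlgType k)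
    (f : {lrmorphism A -> B}) (a : A) :
  (exists u, a * u = 1) -> f a <> 0.
Proof.
move=> [u au1] fa0; have /eqP[] := oner_neq0 B.
by rewrite -(rmorph1 f) -au1 rmorphM /= fa0 mul0r.
Qed.

Lemma field_ex (B : comNzRingType) :
    (forall b : B, b != 0 -> exists c, c * b = 1) ->
  exists (F : fieldType) (f : {rmorphism B -> F}), injective f.
Proof.
move=> B_inv.
have /choice[inv invP] (b : B) :
    exists c, (b != 0 -> c * b = 1) /\ (b = 0 -> c = 0).
  have [->|/[dup] b0 /B_inv[c cE]] := eqVneq b 0; first by exists 0.
  by exists c; split=> // /eqP; rewrite (negPf b0).
have invV (b : B) : b != 0 -> inv b * b = 1 by case: (invP b).
have inv0 : inv 0 = 0 by case: (invP 0) => _; apply.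
pose F : fieldType := HB.pack (GRing.ComNzRing.sort B)
  (GRing.ComNzRing_isField.Build B invV inv0).
by exists F, (idfun : {rmorphism B -> B}).
Qed.

(** A nonunit lies in a maximal ideal, by Zorn's lemma; the quotient by it is
    the field. *)
Lemma residue_field (A : comNzRingType) (a : A) : (forall u, u * a <> 1) ->
  exists (F : fieldType) (f : {rmorphism A -> F}), f a = 0.
Proof.
move=> aU.
pose P (I : A -> Prop) := [/\ is_ideal I, ~ I 1 & I a].
pose T := {I | P I}.
pose R (I J : T) := `[< forall x, sval I x -> sval J x >].
have aP : P (fun b => exists c, b = c * a).
  split; [exact: principal_ideal|by move=> [c /esym/aU]|].
  by exists 1; rewrite mul1r.
have [||||M Mmax] := @classical_sets.Zorn T R.
- by move=> I; apply/asboolP.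
- by move=> I J K /asboolP IJ /asboolP JK; apply/asboolP => x /IJ/JK.
- move=> [I IP] [J JP] /asboolP IJ /asboolP JI; apply/eq_exist/funext => x.
  by apply/propext; split; [apply: IJ|apply: JI].
- move=> C Ctot; have [[I0 CI0]|C0] := pselect (exists I, C I); last first.
    by exists (exist P _ aP) => I CI; case: C0; exists I.
  pose U x := exists2 I, C I & sval I x.
  have UP : P U.
    split; last by exists I0 => //; case: (svalP I0).
      split; first by exists I0 => //; case: (svalP I0) => -[].
        move=> x y [I CI Ix] [J CJ Jy].
        have [/asboolP IJ|/asboolP JI] := Ctot I J CI CJ.
          exists J => //; have [[_ JD _] _ _] := svalP J.
          by apply: JD => //; apply: IJ.
        exists I => //; have [[_ ID _] _ _] := svalP I.
        by apply: ID => //; apply: JI.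
      move=> x y [I CI Iy]; exists I => //.
      by have [[_ _ IM] _ _] := svalP I; apply: IM.
    by move=> [I CI I1]; have [_ NI1 _] := svalP I; apply: NI1.
  by exists (exist P _ UP) => I CI; apply/asboolP => x Ix; exists I.
have [[M0 MD MM] M1 Ma] := svalP M.
pose S : {pred A} := fun x => `[< sval M x >].
have SI : idealr_closed S.
  split; [exact/asboolP|by apply/negP => /asboolP|].
  by move=> x y z /asboolP My /asboolP Mz; apply/asboolP/MD => //; apply: MM.
pose S' : idealr A := HB.pack S (isIdealr.Build A S SI).
pose B := {ideal_quot S'}; pose p : {rmorphism A -> B} := \pi_B%qT.
have p0 x : (p x == 0) = (x \in S').
  have := Quotient.idealrBE S' x 0; rewrite subr0 => ->.
  by rewrite -[X in _ == X](rmorph0 p).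
have [b|F [f _]] := @field_ex B; last first.
  exists F, (f \o p) => /=; rewrite (_ : p a = 0) ?rmorph0 //.
  by apply/eqP; rewrite p0; apply/asboolP.
(* A nonzero class p x is invertible: the ideal generated by M and x is the
   whole ring, by maximality of M. *)
have <- : p (repr b) = b by apply: reprK.
rewrite p0 => bS; pose x := repr b.
pose I y := exists m c, sval M m /\ y = m + c * x.
have [|I1] := pselect (I 1).
  move=> [m [c [Mm E]]]; exists (p c).
  rewrite -rmorphM -[1](rmorph1 p) E rmorphD.
  by rewrite [X in _ = X + _](_ : _ = 0) ?add0r //; apply/eqP; rewrite p0; apply/asboolP.
have IP : P I.
  split=> //; last by exists a, 0; rewrite mul0r addr0.
  split; first by exists 0, 0; rewrite mul0r addr0.
    move=> _ _ [m [c [Mm ->]]] [m' [c' [Mm' ->]]].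
    by exists (m + m'), (c + c'); rewrite mulrDl addrACA; split=> //; apply: MD.
  move=> y _ [m [c [Mm ->]]]; exists (y * m), (y * c).
  by rewrite mulrDr mulrA; split=> //; apply: MM.
have IM : exist P I IP = M.
  by apply: Mmax; apply/asboolP => y My; exists y, 0; rewrite mul0r addr0.
case/negP: bS; apply/asboolP; rewrite -/x -IM /=.
by exists 0, 1; rewrite add0r mul1r.
Qed.

End Quotients.

(** * Calculus in the Grothendieck group *)

Section GrothendieckGroup.
Variable k : fieldType.
Implicit Types (s t u : kform k) (X Y W : variety k).

Lemma K0_catCA s t u : K0_eq (s ++ t ++ u) (t ++ s ++ u).
Proof.
by rewrite !catA; apply: K0_cat; [apply: K0_catC | apply: K0_refl].
Qed.

Lemma K0_catACA s t s' t' :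
  K0_eq ((s ++ t) ++ (s' ++ t')) ((s ++ s') ++ (t ++ t')).
Proof.
rewrite -!catA; apply: K0_cat; first exact: K0_refl.
exact: K0_catCA.
Qed.

Lemma kscale0 s : K0_eq (kscale 0 s) [::].
Proof.
elim: s => [|[c X] s IHs]; first exact: K0_refl.
rewrite /= mul0r -cat1s -[[::]]/([::] ++ [::]).
by apply: K0_cat IHs; apply: K0_zero.
Qed.

Lemma kscale1 s : kscale 1 s = s.
Proof. by elim: s => [|[c X] s /= ->]; rewrite ?mul1r. Qed.

Lemma kscaleD a b s : K0_eq (kscale a s ++ kscale b s) (kscale (a + b) s).
Proof.
elim: s => [|[c X] s IHs]; first exact: K0_refl.
change (K0_eq (([:: (a * c, X)] ++ kscale a s) ++
                ([:: (b * c, X)] ++ kscale b s))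
              ([:: ((a + b) * c, X)] ++ kscale (a + b) s)).
apply: K0_trans (K0_catACA _ _ _ _) _.
by apply: K0_cat IHs; rewrite mulrDl; apply: K0_add.
Qed.

Lemma kscaleN s : K0_eq (s ++ kscale (-1) s) [::].
Proof.
rewrite -{1}[s]kscale1; apply: K0_trans (kscaleD 1 (-1) s) _.
by rewrite subrr; apply: kscale0.
Qed.

(** Subtraction in the Grothendieck group: formal combinations have no opposite,
    but [kscale (-1) t] is one up to the relations. *)
Lemma K0_cancel s s' t t' :
  K0_eq (s ++ t) (s' ++ t') -> K0_eq t t' -> K0_eq s s'.
Proof.
move=> st tt'; pose n := kscale (-1) t.
have add_n r : K0_eq (r ++ (t ++ n)) r.
  rewrite -[X in K0_eq _ X]cats0; apply: K0_cat; first exact: K0_refl.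
  exact: kscaleN.
apply: K0_trans (K0_sym (add_n s)) _; apply: K0_trans (add_n s').
rewrite !catA; apply: K0_cat (K0_refl n).
apply: K0_trans st _; apply: K0_cat (K0_refl s') _; exact: K0_sym.
Qed.

(** For X empty, the closed subscheme Z = X has complement X as well, so the
    scissor relation reads [X] = [X] + [X]. *)
Lemma K0_empty X :
  affine_ft X -> (forall A, X A -> False) -> K0_eq (kclass X) [::].
Proof.
move=> Xaff X0.
pose Z := @Subfunctor k X (fun _ _ => True) (fun _ _ _ _ _ => Logic.I).
have no_iso (Y : kfunctor k) (Y0 : forall A, Y A -> False) : kiso Y X.
  exists (fun A y => False_rect _ (Y0 A y)), (fun A x => False_rect _ (X0 A x)).
  by split=> [A B f y|A y|A x]; [case: (Y0 A y)|case: (Y0 A y)|case: (X0 A x)].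
have ZX : kiso (sub_kfunctor Z) X by apply: no_iso => A [x _]; apply: (X0 A).
have UX : kiso (sub_kfunctor (compl_sub Z)) X.
  by apply: no_iso => A [x _]; apply: (X0 A).
have ZP := affine_variety (affine_ft_iso ZX Xaff).
have UP := affine_variety (affine_ft_iso UX Xaff).
have Zcl : closed_sub Z by move=> A x; case: (X0 A x).
have XE := K0_scissor ZP UP Zcl.
apply: K0_cancel (K0_refl (kclass X)).
apply: K0_sym; rewrite cat0s; apply: K0_trans XE _.
by apply: K0_cat; apply: K0_iso.
Qed.

(** The scissor relation with both pieces replaced by isomorphic affine
    varieties; affineness makes the pieces themselves varieties. *)
Lemma K0_scissor_affine X Y W (Z : subfunctor X) : closed_sub Z ->
    affine_ft Y -> kiso (sub_kfunctor Z) Y ->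
    affine_ft W -> kiso (sub_kfunctor (compl_sub Z)) W ->
  K0_eq (kclass X) (kclass Y ++ kclass W).
Proof.
move=> Zcl Yaff ZY Waff UW.
have ZP := affine_variety (affine_ft_iso ZY Yaff).
have UP := affine_variety (affine_ft_iso UW Waff).
apply: K0_trans (K0_scissor ZP UP Zcl) _.
by apply: K0_cat; apply: K0_iso.
Qed.

Section Evaluation.
Variable s : kform k.

(** [keval] with the number of terms decoupled from the size of the polynomial,
    so that two polynomials can be added term by term. *)
Definition kcomb (c : nat -> int) (m : nat) : kform k :=
  flatten [seq kscale (c i) (kexp s i) | i <- iota 0 m].

Lemma kcombS c m : kcomb c m.+1 = kcomb c m ++ kscale (c m) (kexp s m).
Proof. by rewrite /kcomb -addn1 iotaD map_cat flatten_cat /= add0n cats0. Qed.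

Lemma kcomb0 c m : (forall i, (i < m)%N -> c i = 0) -> K0_eq (kcomb c m) [::].
Proof.
elim: m => [|m IHm] c0; first exact: K0_refl.
rewrite kcombS c0 // -[[::]]/([::] ++ [::]).
by apply: K0_cat (kscale0 _); apply: IHm => i /ltnW/c0.
Qed.

Lemma kcombD c c' m :
  K0_eq (kcomb c m ++ kcomb c' m) (kcomb (fun i => c i + c' i) m).
Proof.
elim: m => [|m IHm]; first exact: K0_refl.
rewrite !kcombS; apply: K0_trans (K0_catACA _ _ _ _) _.
by apply: K0_cat IHm _; apply: kscaleD.
Qed.

Lemma keval_widen (p : {poly int}) m : (size p <= m)%N ->
  K0_eq (keval p s) (kcomb (fun i => p`_i) m).
Proof.
move=> /subnKC <-; elim: (m - _)%N => [|j IHj]; first by rewrite addn0; apply: K0_refl.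
rewrite addnS kcombS -[keval p s]cats0; apply: K0_cat IHj _.
by rewrite nth_default ?leq_addr //; apply: K0_sym (kscale0 _).
Qed.

Lemma kevalD p q : K0_eq (keval (p + q) s) (keval p s ++ keval q s).
Proof.
pose m := maxn (size p) (size q).
apply: K0_trans (keval_widen (size_polyD p q)) _; apply: K0_sym.
apply: K0_trans (K0_cat (keval_widen (leq_maxl _ _ : _ <= m)%N)
                        (keval_widen (leq_maxr _ _ : _ <= m)%N)) _.
apply: K0_trans (kcombD _ _ _) _.
rewrite (_ : (fun i => _) = fun i => (p + q)`_i); first exact: K0_refl.
by apply/funext => i; rewrite coefD.
Qed.

Lemma kevalXn m : K0_eq (keval 'X^m s) (kexp s m).
Proof.
apply: K0_trans (keval_widen (m := m.+1) _) _; first by rewrite size_polyXn.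
rewrite kcombS coefXn eqxx kscale1 -[X in K0_eq _ X]cat0s.
apply: K0_cat (K0_refl _); apply: kcomb0 => i im.
by rewrite coefXn ltn_eqF.
Qed.

End Evaluation.

Lemma affine_spaceS i :
  kiso (affine_space k i.+1)
       (prod_kfunctor (affine_space k 1) (affine_space k i)).
Proof.
pose u (A : comAlgType k) (x : affine_space k i.+1 A) :
    prod_kfunctor (affine_space k 1) (affine_space k i) A :=
  (exist _ (fun=> sval x ord0) (fun p => @False_ind _),
   exist _ (fun j => sval x (lift ord0 j)) (fun p => @False_ind _)).
apply: (kiso_bij (u := u)) => [A B f x|A [v Pv] [w Pw] [vw0 vwS]|A [[a Pa] [v Pv]]].
- by congr (_, _); apply/eq_exist.
- apply/eq_exist/funext => j; case: (unliftP ord0 j) => [j'|] ->.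
    exact: (congr1 (fun g => g j') vwS).
  exact: (congr1 (fun g => g ord0) vw0).
- exists (exist _ (fun j => if unlift ord0 j is Some j' then v j' else a ord0)
                  (fun p => @False_ind _)).
  congr (_, _); apply/eq_exist/funext => j /=.
    by rewrite (ord1 j) unlift_none.
  by rewrite liftK.
Qed.

Lemma kexp_affine i : K0_eq (kexp (kclass (affine_space k 1)) i)
                            (kclass (affine_space k i)).
Proof.
suff [Y [-> YA]] : exists Y, kexp (kclass (affine_space k 1)) i = kclass Y /\
    kiso Y (affine_space k i) by apply: K0_iso.
elim: i => [|i [Y [YE YA]]].
  exists (affine_space k 0); split=> //; exact: kiso_refl.
exists (prod_variety (affine_space k 1) Y); split.
  by rewrite /kexp iterS -/(kexp _ _) YE.
apply: kiso_trans (kiso_sym (affine_spaceS i)).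
by apply: kiso_prod => //; apply: kiso_refl.
Qed.

End GrothendieckGroup.

(** * Loci of polynomial equations and one inverted polynomial *)

Section PolynomialEvaluation.
Variable k : fieldType.

Lemma mpoly_evalB n (A : comAlgType k) (v : 'I_n -> A) p q :
  mpoly_eval v (p - q) = mpoly_eval v p - mpoly_eval v q.
Proof. exact: mmapB. Qed.

Lemma mpoly_evalM n (A : comAlgType k) (v : 'I_n -> A) p q :
  mpoly_eval v (p * q) = mpoly_eval v p * mpoly_eval v q.
Proof. exact: rmorphM. Qed.

Lemma mpoly_eval1 n (A : comAlgType k) (v : 'I_n -> A) : mpoly_eval v 1 = 1.
Proof. exact: rmorph1. Qed.

Lemma mpoly_evalX n (A : comAlgType k) (v : 'I_n -> A) i :
  mpoly_eval v 'X_i = v i.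
Proof. by rewrite /mpoly_eval mmapX mmap1U. Qed.

Lemma mpoly_eval_widen n (A : comAlgType k) (w : 'I_n.+1 -> A) p :
  mpoly_eval w (mwiden p) = mpoly_eval (fun i => w (widen_ord (leqnSn n) i)) p.
Proof.
rewrite /mpoly_eval; elim/mpolyind: p => [|c m p _ _ IHp].
  by rewrite mwiden0 !mmap0.
rewrite mwidenD !mmapD IHp mwidenZ !mmapZ mwidenX !mmapX; congr (_ * _ + _).
rewrite /mmap1 big_ord_recr /= mnmwiden_ordmax expr0 mulr1.
by apply: eq_bigr => i _; rewrite mnmwiden_widen.
Qed.

End PolynomialEvaluation.

Section Locus.
Variables (k : fieldType) (n : nat).
Implicit Types (P : seq {mpoly k[n]}) (q l : {mpoly k[n]}).

Definition locus_pred P q (A : comAlgType k) (v : 'I_n -> A) : Prop :=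
  (forall p, p \in P -> mpoly_eval v p = 0) /\
  exists u, mpoly_eval v q * u = 1.

Definition locus_points P q (A : comAlgType k) : Type :=
  {v : 'I_n -> A | locus_pred P q v}.

Lemma locus_pred_comp P q (A B : comAlgType k) (f : {lrmorphism A -> B}) v :
  locus_pred P q v -> locus_pred P q (f \o v).
Proof.
move=> [Pv [u vu]]; split=> [p pP|].
  by rewrite -mpoly_eval_fmap Pv // rmorph0.
by exists (f u); rewrite -mpoly_eval_fmap -rmorphM vu rmorph1.
Qed.

Definition locus_fmap P q (A B : comAlgType k) (f : {lrmorphism A -> B})
    (v : locus_points P q A) : locus_points P q B :=
  exist _ (f \o sval v) (locus_pred_comp f (svalP v)).

Lemma locus_fmap_id P q (A : comAlgType k) (f : {lrmorphism A -> A}) v :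
  f =1 id -> @locus_fmap P q A A f v = v.
Proof. by case: v => v Pv fid; apply/eq_exist/funext => i; apply: fid. Qed.

Lemma locus_fmap_comp P q (A B C : comAlgType k) (f : {lrmorphism A -> B})
    (g : {lrmorphism B -> C}) (h : {lrmorphism A -> C}) v :
  h =1 g \o f ->
  @locus_fmap P q _ _ h v = locus_fmap g (@locus_fmap P q _ _ f v).
Proof. by case: v => v Pv hE; apply/eq_exist/funext => i; apply: hE. Qed.

Definition locus P q : kfunctor k :=
  KFunctor (@locus_fmap_id P q) (@locus_fmap_comp P q).

(** Rabinowitsch: inverting q amounts to an extra coordinate u with q u = 1. *)
Lemma locus_affine P q : affine_ft (locus P q).
Proof.
pose P' (p : {mpoly k[n.+1]}) :=
  (exists2 p', p' \in P & p = mwiden p') \/ p = mwiden q * 'X_ord_max - 1.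
exists n.+1, P'; apply: kiso_sym.
pose r (A : comAlgType k) (w : 'I_n.+1 -> A) :=
  fun i : 'I_n => w (widen_ord (leqnSn n) i).
have rP A (w : zero_kfunctor P' A) : locus_pred P q (r A (sval w)).
  case: w => w P'w /=; split=> [p pP|].
    by rewrite -mpoly_eval_widen; apply: P'w; left; exists p.
  have /P'w/eqP : P' (mwiden q * 'X_ord_max - 1) by right.
  rewrite mpoly_evalB mpoly_eval1 subr_eq0 mpoly_evalM mpoly_eval_widen.
  by rewrite mpoly_evalX => /eqP; exists (w ord_max).
have wE (A : comAlgType k) (w : 'I_n.+1 -> A) j :
    w j = if insub (j : nat) is Some i then r A w i else w ord_max.
  case: insubP => [i ij ji|]; first by congr w; apply: val_inj.
  by rewrite -leqNgt => nj; congr w; apply/val_inj/eqP; rewrite eqn_leq nj -ltnS ltn_ord.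
pose u A (w : zero_kfunctor P' A) : locus P q A := exist _ _ (rP A w).
apply: (kiso_bij (u := u)).
- by move=> A B f w; apply: eq_exist.
- move=> A [w P'w] [w' P'w'] /(congr1 sval) /= rE.
  apply/eq_exist/funext => j; rewrite wE [RHS]wE rE.
  have last_inv x : (forall p, P' p -> mpoly_eval x p = 0) ->
      mpoly_eval (r A x) q * x ord_max = 1.
    move=> P'x; have /P'x/eqP : P' (mwiden q * 'X_ord_max - 1) by right.
    rewrite mpoly_evalB mpoly_eval1 subr_eq0 mpoly_evalM mpoly_eval_widen.
    by rewrite mpoly_evalX => /eqP.
  rewrite (_ : w ord_max = w' ord_max) //.
  rewrite -[LHS]mulr1 -(last_inv w' P'w') -rE mulrCA mulrA (last_inv w P'w).
  exact: mul1r.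
- move=> A [v [Pv [t vt]]].
  pose w (j : 'I_n.+1) := if insub (j : nat) is Some i then v i else t.
  have rw : r A w = v by apply/funext => i; rewrite /r /w /= valK.
  have wmax : w ord_max = t by rewrite /w insubF //= ltnn.
  have P'w p : P' p -> mpoly_eval w p = 0.
    case=> [[p' pP ->]|->]; first by rewrite mpoly_eval_widen -/(r A w) rw Pv.
    rewrite mpoly_evalB mpoly_eval1 mpoly_evalM mpoly_eval_widen mpoly_evalX.
    by rewrite -/(r A w) rw wmax vt subrr.
  by exists (exist _ w P'w); apply: eq_exist.
Qed.

Definition locus_variety P q : variety k :=
  Variety (affine_variety (locus_affine P q)).

(** The points where l vanishes form a closed subfunctor; a point lies in its
    open complement iff no nonzero algebra kills the value of l, that is, iff
    this value is invertible. *)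
Lemma locus_scissor P q l :
  K0_eq (kclass (locus_variety P q))
        (kclass (locus_variety (l :: P) q) ++
         kclass (locus_variety P (l * q))).
Proof.
pose V (A : comAlgType k) (v : locus P q A) := mpoly_eval (sval v) l = 0.
have VN (A B : comAlgType k) (f : {lrmorphism A -> B}) v :
    V A v -> V B (fmap (locus P q) f v).
  by case: v => v Pv; rewrite /V /= -mpoly_eval_fmap => ->; rewrite rmorph0.
pose Z : subfunctor (locus_variety P q) := Subfunctor VN.
apply: (@K0_scissor_affine k _ _ _ Z).
- move=> A [v Pv]; exists (fun a => a = mpoly_eval v l) => B f.
  rewrite /= /V /= -mpoly_eval_fmap; split=> [fv a ->|] //.
  by apply.
- exact: locus_affine.
- have ZP A (x : sub_kfunctor Z A) : locus_pred (l :: P) q (sval (sval x)).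
    case: x => -[v [Pv vq]] /= vl; split=> // p.
    by rewrite inE => /predU1P[->|/Pv].
  pose u A (x : sub_kfunctor Z A) : locus (l :: P) q A := exist _ _ (ZP A x).
  apply: (kiso_bij (u := u)).
  + by move=> A B f x; apply: eq_exist.
  + by move=> A [[v Pv] vl] [[w Pw] wl] /(congr1 sval) /= vw; do 2!apply: eq_exist.
  + move=> A [v [lPv vq]].
    have Pv : locus_pred P q v.
      by split=> // p pP; apply: lPv; rewrite inE pP orbT.
    have vl : mpoly_eval v l = 0 by apply: lPv; rewrite mem_head.
    by exists (exist _ (exist _ v Pv) vl); apply: eq_exist.
- exact: locus_affine.
- have UP A (x : sub_kfunctor (compl_sub Z) A) :
      locus_pred P (l * q) (sval (sval x)).
    case: x => -[v [Pv [u vu]]] /= vl; split=> //.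
    have [|t vt] := @unit_of_nonzero k A (mpoly_eval v l).
      by move=> B f fv; apply: (vl B f); rewrite /= /V /= -mpoly_eval_fmap.
    by exists (t * u); rewrite mpoly_evalM mulrACA vt vu mulr1.
  pose u A (x : sub_kfunctor (compl_sub Z) A) : locus P (l * q) A :=
    exist _ _ (UP A x).
  apply: (kiso_bij (u := u)).
  + by move=> A B f x; apply: eq_exist.
  + by move=> A [[v Pv] vl] [[w Pw] wl] /(congr1 sval) /= vw; do 2!apply: eq_exist.
  + move=> A [v Plv]; have [Pv [t]] := Plv; rewrite mpoly_evalM => vt.
    have Pqv : locus_pred P q v.
      by split=> //; exists (mpoly_eval v l * t); rewrite mulrCA mulrA.
    have Uv : @compl_pred k _ Z A (exist _ v Pqv).
      move=> B f; rewrite /= /V /= -mpoly_eval_fmap; apply: unit_nonzero.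
      by exists (mpoly_eval v q * t); rewrite mulrA.
    by exists (exist _ (exist _ v Pqv) Uv); apply: eq_exist.
Qed.

End Locus.

(** * Linear forms and affine subspaces *)

(** Linear conditions implied over the base field are implied for an explicit
    reason, a factorization of matrices.  This form of the implication persists
    after extension of scalars to any algebra, see [mul_map_mx0]. *)
Lemma mulmx_factor (k : fieldType) n r s (C : 'M[k]_(n, r)) (D : 'M[k]_(n, s)) :
    (forall w : 'rV_n, w *m C = 0 -> w *m D = 0) ->
  exists G, D = C *m G.
Proof.
move=> CD; exists (pinvmx C *m D); apply/eqP; rewrite mulmxA -subr_eq0.
rewrite -{1}[D]mul1mx -mulmxBl; apply/eqP/row_matrixP => i.
rewrite row_mul row0; apply: CD.
(* The rows of 1 - C C^+ are in the kernel of C. *)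
by rewrite -row_mul mulmxBl mul1mx mulmxKpV // subrr row0.
Qed.

Section LinearForms.
Variables (k : fieldType) (n : nat).
Implicit Types (l : 'cV[k]_n.+1) (F : seq 'cV[k]_n.+1).

Lemma map_in_alg (A B : comAlgType k) (f : {lrmorphism A -> B}) r s
    (M : 'M[k]_(r, s)) :
  map_mx f (map_mx (in_alg A) M) = map_mx (in_alg B) M.
Proof. by apply/matrixP => i j; rewrite !mxE /= linearZ /= rmorph1. Qed.

Definition form_poly l : {mpoly k[n.+1]} := \sum_j l j 0 *: 'X_j.

Lemma eval_form_poly (A : comAlgType k) (v : 'rV[A]_n.+1) l :
  mpoly_eval (v 0) (form_poly l) = (v *m map_mx (in_alg A) l) 0 0.
Proof.
rewrite /mpoly_eval /form_poly raddf_sum mxE; apply: eq_bigr => j _.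
by rewrite /= mmapZ mmapX mmap1U mulrC !mxE.
Qed.

Lemma mem_central_hyperplane l (w : 'rV[k]_n.+1) :
  (w \in central_hyperplane l) = (w *m l == 0).
Proof. by rewrite memv_ker lfunE. Qed.

Lemma mem_bigcap_hyperplane F (w : 'rV[k]_n.+1) :
  reflect (forall l, l \in F -> w *m l = 0)
          (w \in (\bigcap_(l <- F) central_hyperplane l)%VS).
Proof.
elim: F => [|l F IHF]; first by rewrite big_nil memvf; left.
rewrite big_cons memv_cap mem_central_hyperplane.
apply: (iffP andP) => [[/eqP wl /IHF wF] l'|wF].
  by rewrite inE => /predU1P[->|/wF].
split; first by apply/eqP/wF; rewrite mem_head.
by apply/IHF => l' l'F; apply: wF; rewrite inE l'F orbT.
Qed.

Lemma dim_cap_hyperplane l (x : {vspace 'rV[k]_n.+1}) :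
  ~~ (x <= central_hyperplane l)%VS ->
  \dim x = (\dim (x :&: central_hyperplane l)).+1.
Proof.
move=> xl; have := limg_ker_dim (linfun (mulmxr l : 'rV_n.+1 -> 'rV_1)) x.
rewrite -/(central_hyperplane l).
set y := (_ @: x)%VS => <-; suff -> : \dim y = 1%N by rewrite addn1.
apply/eqP; rewrite eqn_leq lt0n dimv_eq0; apply/andP; split.
  by apply: leq_trans (dimvS (subvf _)) _; rewrite dimvf /dim /= muln1.
by apply: contra xl; rewrite -lkerE.
Qed.

Definition forms_mx F : 'M[k]_(n.+1, size F) := \matrix_(j, i) F`_i j 0.

(** Stated for any ring morphism f out of k, to be used both for the structure
    map of a k-algebra and for the identity of k. *)
Lemma mul_forms_mxP (R : comNzRingType) (f : {rmorphism k -> R})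
    (v : 'rV[R]_n.+1) F :
  (forall l, l \in F -> v *m map_mx f l = 0) <-> v *m map_mx f (forms_mx F) = 0.
Proof.
have vE i : (v *m map_mx f (forms_mx F)) 0 i = (v *m map_mx f F`_i) 0 0.
  by rewrite !mxE; apply: eq_bigr => j _; rewrite !mxE.
split=> [vF|vF l /(nthP 0)[i iF <-]]; apply/rowP => j.
  by rewrite vE vF ?mem_nth // !mxE.
by rewrite (ord1 j) -(vE (Ordinal iF)) vF !mxE.
Qed.

(** By [mulmx_factor], D is over k a right multiple of the matrix of the equations
    F, and this relation persists over A. *)
Lemma mul_map_mx0 (A : comAlgType k) (v : 'rV[A]_n.+1) F s
    (D : 'M[k]_(n.+1, s)) :
    (forall w, w \in (\bigcap_(l <- F) central_hyperplane l)%VS -> w *m D = 0) ->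
    (forall l, l \in F -> v *m map_mx (in_alg A) l = 0) ->
  v *m map_mx (in_alg A) D = 0.
Proof.
move=> FD /mul_forms_mxP vF.
have [w wF|G ->] := @mulmx_factor k _ _ _ (forms_mx F) D.
  apply/FD/mem_bigcap_hyperplane => l lF.
  have /mul_forms_mxP/(_ l lF) : w *m map_mx idfun (forms_mx F) = 0.
    by rewrite map_mx_id.
  by rewrite map_mx_id.
by rewrite map_mxM mulmxA vF mul0mx.
Qed.

(** A basis of y as the rows of B; the right inverse B' computes coordinates,
    also after extension of scalars. *)
Lemma vspace_mx (y : {vspace 'rV[k]_n.+1}) :
  exists (B : 'M[k]_(\dim y, n.+1)) (B' : 'M[k]_(n.+1, \dim y)),
    B *m B' = 1%:M /\ forall w : 'rV_n.+1,
      w \in y <-> exists u : 'rV_(\dim y), w = u *m B.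
Proof.
pose B : 'M[k]_(\dim y, n.+1) := \matrix_i (vbasis y)`_i.
have uBE u : u *m B = \sum_i u 0 i *: (vbasis y)`_i.
  by rewrite mulmx_sum_row; apply: eq_bigr => i _; rewrite rowK.
have /row_freeP[B' BB'] : row_free B.
  apply: inj_row_free => u; rewrite uBE => u0.
  have /freeP/(_ (fun i => u 0 i) u0) ui := basis_free (vbasisP y).
  by apply/rowP => i; rewrite mxE ui.
exists B, B'; split=> // w; split=> [wy|[u ->]].
  exists (\row_i coord (vbasis y) i w); rewrite uBE {1}(coord_vbasis wy).
  by apply: eq_bigr => i _; rewrite mxE.
rewrite uBE; apply: memv_suml => i _; apply/memvZ/vbasis_mem.
by rewrite mem_nth ?size_tuple.
Qed.

Section AffineSubspace.
Variables (l0 : 'cV[k]_n.+1) (F : seq 'cV[k]_n.+1).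
Let x := (\bigcap_(l <- F) central_hyperplane l)%VS.
Let P := rcons [seq form_poly l | l <- F] (form_poly l0 - 1).

Lemma form_locusP q (A : comAlgType k) (v : 'rV[A]_n.+1) :
  locus_pred P q (v 0) <->
  [/\ forall l, l \in F -> v *m map_mx (in_alg A) l = 0,
      (v *m map_mx (in_alg A) l0) 0 0 = 1 &
      exists u, mpoly_eval (v 0) q * u = 1].
Proof.
split=> [[Pv vq]|[vF v0 vq]]; split=> //.
- move=> l lF; apply/rowP => j; rewrite (ord1 j) -eval_form_poly mxE.
  by apply: Pv; rewrite mem_rcons inE map_f ?orbT.
- apply/eqP; rewrite -eval_form_poly -subr_eq0 -(mpoly_eval1 (v 0)).
  by rewrite -mpoly_evalB Pv // mem_rcons mem_head.
- move=> p; rewrite mem_rcons inE => /predU1P[->|/mapP[l lF ->]].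
    by rewrite mpoly_evalB mpoly_eval1 eval_form_poly v0 subrr.
  by rewrite eval_form_poly vF // mxE.
Qed.

(** If x lies in H_0, then l_0 is over k a linear combination of the equations
    of x, so l_0(v) = 0 for each v satisfying them over A, whereas l_0(v) = 1. *)
Lemma form_locus_empty q (A : comAlgType k) :
  (x <= central_hyperplane l0)%VS -> locus P q A -> False.
Proof.
move=> /subvP xl0 [v Pv]; have {Pv}: locus_pred P q ((\row_j v j) 0).
  by rewrite (_ : (\row_j v j) 0 = v) //; apply/funext => j; rewrite mxE.
move=> /form_locusP[vF /eqP v0 _]; case/negP: (negbT (oner_eq0 A)).
rewrite -(eqP v0) (mul_map_mx0 _ vF) ?mxE // => w /xl0.
by rewrite mem_central_hyperplane => /eqP.
Qed.

(** If v0 is a vector of x with l_0(v0) = 1, the affine subspace is v0 + y with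
    y = x \cap H_0, and it is parametrized by coordinates with respect to a
    basis of y.  Over an algebra A, surjectivity means that each W over A which
    is killed by the equations of y satisfies W = W B' B; this identity holds
    over k, hence over A by [mul_map_mx0]. *)
Lemma form_locus_affine_space : ~~ (x <= central_hyperplane l0)%VS ->
  kiso (locus P 1) (affine_space k (\dim (x :&: central_hyperplane l0))).
Proof.
move=> /subvPn[w wx]; rewrite mem_central_hyperplane => wl0.
pose a := (w *m l0) 0 0.
have a0 : a != 0.
  by apply: contraNneq wl0 => a0; apply/eqP/rowP => j; rewrite (ord1 j) [RHS]mxE.
pose v0 := a^-1 *: w.
have v0F l : l \in F -> v0 *m l = 0.
  move=> lF; have /mem_bigcap_hyperplane wF := wx.
  by rewrite -scalemxAl wF // scaler0.
have v0l0 : v0 *m l0 = 1%:M.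
  by apply/matrixP => i j; rewrite !ord1 -scalemxAl [LHS]mxE -/a mulVf // mxE eqxx.
set y := (x :&: _)%VS; have [B [B' [BB' yB]]] := vspace_mx y.
have yP u : u \in y <-> forall l, l \in l0 :: F -> u *m l = 0.
  rewrite /y capvC; split=> [|uF].
    rewrite memv_cap mem_central_hyperplane.
    case/andP => /eqP ul0 /mem_bigcap_hyperplane uF l.
    by rewrite inE => /predU1P[->|/uF].
  rewrite memv_cap mem_central_hyperplane uF ?mem_head // eqxx /=.
  by apply/mem_bigcap_hyperplane => l lF; apply: uF; rewrite inE lF orbT.
have Bl l : l \in l0 :: F -> B *m l = 0.
  move=> lF; apply/row_matrixP => i; rewrite row_mul row0.
  have /yP -> // : row i B \in y by apply/yB; exists (delta_mx 0 i); rewrite -rowE.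
pose par (A : comAlgType k) (c : 'I_(\dim y) -> A) :=
  map_mx (in_alg A) v0 + (\row_j c j) *m map_mx (in_alg A) B.
have parl (A : comAlgType k) (c : 'I_(\dim y) -> A) l :
    l \in l0 :: F ->
    par A c *m map_mx (in_alg A) l = map_mx (in_alg A) (v0 *m l).
  by move=> lF; rewrite mulmxDl -mulmxA -!map_mxM Bl // map_mx0 mulmx0 addr0.
have parP (A : comAlgType k) (c : 'I_(\dim y) -> A) : locus_pred P 1 (par A c 0).
  apply/form_locusP; split.
  - by move=> l lF; rewrite parl ?inE ?lF ?orbT // v0F // map_mx0.
  - by rewrite parl ?mem_head // v0l0 map_mx1 mxE eqxx.
  - by exists 1; rewrite mpoly_eval1 mulr1.
apply: kiso_sym.
pose u A (c : affine_space k (\dim y) A) : locus P 1 A :=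
  exist _ _ (parP A (sval c)).
apply: (kiso_bij (u := u)) => [A C f [c cP]|A [c cP] [d dP]|A [v vP]].
- apply/eq_exist/funext => j /=; rewrite /par !mxE rmorphD /=.
  rewrite linearZ /= rmorph1 rmorph_sum; congr (_ + _); apply: eq_bigr => i _.
  by rewrite !mxE rmorphM /= linearZ /= rmorph1.
- move=> /(congr1 sval) /= cd; apply/eq_exist/funext => j.
  have {}cd : par A c = par A d.
    by apply/rowP => i; rewrite -[LHS]/((par A c 0) i) cd.
  have /addrI/(congr1 (fun M => (M *m map_mx (in_alg A) B') 0 j)) := cd.
  by rewrite -!mulmxA -!map_mxM BB' !map_mx1 !mulmx1 !mxE.
- pose V : 'rV[A]_n.+1 := \row_j v j.
  have VE : V 0 = v by apply/funext => j; rewrite mxE.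
  have : locus_pred P 1 (V 0) by rewrite VE.
  case/form_locusP => VF Vl0 _; pose W := V - map_mx (in_alg A) v0.
  have WB : W *m map_mx (in_alg A) (1%:M - B' *m B) = 0.
    apply: (mul_map_mx0 (F := l0 :: F)) => [z|l].
      move=> /mem_bigcap_hyperplane/yP/yB[c ->].
      by rewrite mulmxBr mulmx1 mulmxA -[c *m B *m B']mulmxA BB' mulmx1 subrr.
    rewrite inE mulmxBl -map_mxM => /predU1P[->|lF]; last first.
      by rewrite VF // v0F // map_mx0 subrr.
    rewrite v0l0 map_mx1; apply/rowP => j.
    by rewrite (ord1 j) [in LHS]mxE Vl0 !mxE eqxx subrr.
  pose c := W *m map_mx (in_alg A) B'.
  exists (exist _ (c 0) (fun p => @False_ind _)); apply: eq_exist => /=.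
  rewrite -VE; congr (fun M : 'rV[A]_n.+1 => M 0).
  rewrite /par (_ : \row_j _ = c); last by apply/rowP => j; rewrite mxE.
  apply/eqP; rewrite addrC eq_sym -subr_eq -/W -subr_eq0; apply/eqP.
  by rewrite -[RHS]WB map_mxB map_mx1 mulmxBr mulmx1 map_mxM mulmxA.
Qed.

End AffineSubspace.
End LinearForms.

(** * Deletion-restriction and the characteristic polynomial *)

Section DeletionRestriction.
Variables (k : fieldType) (n d : nat) (H : arrangement k n d).
Local Notation flat := {vspace 'rV[k]_n.+1}.
Local Notation hyp i := (central_hyperplane (H i)).
Local Notation L := (arr_lattice H).
Local Notation mu := (arr_mobius H fullv).

(** Removing the hyperplanes of s from x one after the other, for an additive
    invariant whose value on a closed subspace z is f z; for s without
    repetitions it equals \sum_(J \subset s) (-1)^|J| f (x \cap \bigcap_(j in J) H_j). *)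
Fixpoint del_restr (M : zmodType) (f : flat -> M) (x : flat) (s : seq 'I_d) : M :=
  if s is i :: s' then del_restr f x s' - del_restr f (hyp i :&: x)%VS s'
  else f x.

Lemma fullv_lattice : fullv \in L.
Proof. by apply/arr_latticeP; exists set0; rewrite big_set0. Qed.

Lemma lattice_cap i x : x \in L -> (hyp i :&: x)%VS \in L.
Proof.
case/arr_latticeP => J ->; apply/arr_latticeP; exists (i |: J).
apply/eqP; rewrite eqEsubv subv_cap; apply/andP; split.
  apply/subv_bigcapP => j /setU1P[->|jJ]; first exact: capvSl.
  by apply: subv_trans (capvSr _ _) _; rewrite (bigD1 j) //= capvSl.
apply/andP; split; first by rewrite (bigD1 i) ?setU11 //= capvSl.
by apply/subv_bigcapP => j jJ; rewrite (bigD1 j) ?setU1r //= capvSl.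
Qed.

(** The coefficients do not depend on f, so they can be determined by choosing
    test functions f. *)
Lemma del_restr_expand s x : x \in L -> exists c : flat -> int,
  forall (M : zmodType) (f : flat -> M),
    del_restr f x s = \sum_(z <- L) f z *~ c z.
Proof.
elim: s x => [|i s IHs] x xL.
  exists (fun z => (z == x)%:Z) => M f.
  rewrite (bigD1_seq x) ?undup_uniq //= eqxx mulr1z big1 ?addr0 // => z.
  by move=> /negPf ->; rewrite mulr0z.
have [c cE] := IHs x xL; have [c' cE'] := IHs _ (lattice_cap i xL).
exists (fun z => c z - c' z) => M f; rewrite /= cE cE' -sumrB.
by apply: eq_bigr => z _; rewrite mulrzBr.
Qed.

(** For the indicator function of the subspaces containing y, each step of the
    recursion multiplies the value by 1 or 0. *)
Lemma del_restr_indicator y x s :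
  del_restr (fun z => (y <= z)%VS%:Z) x s =
  ((y <= x)%VS && all (fun i => ~~ (y <= hyp i)%VS) s)%:Z.
Proof.
elim: s x => [|i s IHs] x /=; first by rewrite andbT.
rewrite !IHs subv_cap; case: (y <= x)%VS; case: (y <= hyp i)%VS => //=.
- exact: subrr.
- by rewrite subr0.
Qed.

(** Moebius inversion in its uniqueness form: the sums over z containing y are
    unitriangular in c, by induction on the codimension of y. *)
Lemma lattice_sum_inj (c c' : flat -> int) :
    {in L, forall y, \sum_(z <- L | (y <= z)%VS) c z =
                     \sum_(z <- L | (y <= z)%VS) c' z} ->
  {in L, c =1 c'}.
Proof.
move=> cc' y; have [m] := ubnP (n.+1 - \dim y).
elim: m y => // m IHm y ym yL; have := cc' y yL.
have sumE (b : flat -> int) : \sum_(z <- L | (y <= z)%VS) b z =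
    b y + \sum_(z <- L | (z != y) && (y <= z)%VS) b z.
  by rewrite big_mkcond (bigD1_seq y) ?undup_uniq //= subvv -big_mkcondr.
rewrite !sumE big_seq_cond [in RHS]big_seq_cond.
rewrite [in RHS](eq_bigr c) => [/addIr //|z /and3P[zL zNy yz]].
have lt_yz : (\dim y < \dim z)%N.
  rewrite (ltn_leqif (dimv_leqif_sup yz)).
  by apply: contra zNy => zy; rewrite eqEsubv yz zy.
have z_le : (\dim z <= n.+1)%N.
  by apply: leq_trans (dimvS (subvf z)) _; rewrite dimvf /dim /= mul1n.
apply/esym/IHm => //; rewrite ltnS in ym; apply: leq_trans ym.
by rewrite ltn_sub2l // (leq_trans lt_yz).
Qed.

Lemma mobius_lattice_sum y : y \in L ->
  \sum_(z <- L | (y <= z)%VS) mu z = (y == fullv)%:Z.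
Proof.
move=> yL; have [->|yNT] := eqVneq y fullv.
  rewrite big_mkcond (bigD1_seq fullv) ?fullv_lattice ?undup_uniq //= subvv.
  rewrite arr_mobius_diag ?fullv_lattice // -big_mkcondr big1 ?addr0 // => z.
  by case/andP => /negP + Tz; case; rewrite eqEsubv subvf.
apply: etrans (arr_mobius_sum fullv_lattice yL (subvf y) _); last by rewrite eq_sym.
by apply: eq_bigl => z; rewrite /arr_le subvf.
Qed.

(** Whitney's theorem.  By [lattice_sum_inj] it suffices to compare the sums over
    z containing y on both sides.  By [del_restr_indicator] the left hand side
    gives 1 if no hyperplane contains y, that is, if y is the whole space, and
    0 otherwise, which is the defining property of the Moebius function. *)
Lemma whitney (M : zmodType) (f : flat -> M) s : (forall i, i \in s) ->
  del_restr f fullv s = \sum_(z <- L) f z *~ mu z.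
Proof.
move=> s_all; have [c cE] := del_restr_expand s fullv_lattice.
rewrite cE; apply: eq_big_seq => z zL; congr (_ *~ _).
apply: lattice_sum_inj zL => y yL; rewrite mobius_lattice_sum //.
have := del_restr_indicator y fullv s; rewrite cE subvf /= => cy.
transitivity (\sum_(z <- L) (y <= z)%VS%:Z *~ c z).
  rewrite big_mkcond; apply: eq_bigr => x _.
  by case: (y <= x)%VS; rewrite ?mul0rz // mulrzz mul1r.
rewrite cy; congr (_%:Z); congr nat_of_bool; apply/allP/eqP => [yH|-> i _]; last first.
  by apply: contra (central_hyperplane_neqT H i) => TH; rewrite eqEsubv subvf.
have /arr_latticeP[J yE] := yL; rewrite yE; apply: big1 => i iJ.
by have /negP[] := yH i (s_all i); rewrite yE (bigD1 i) //= capvSl.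
Qed.

(** ** Dehomogenization with respect to a hyperplane *)

Section Decone.
Variable i0 : 'I_d.

(** The class of x \cap {l_0 = 1}, as a polynomial in the class of the line. *)
Definition chart_poly (x : flat) : {poly int} :=
  if (x <= hyp i0)%VS then 0 else 'X^(\dim (x :&: hyp i0)).

Lemma chart_polyE x :
  chart_poly x * ('X - 1) = 'X^(\dim x) - 'X^(\dim (hyp i0 :&: x)).
Proof.
rewrite /chart_poly capvC; case: ifPn => [/capv_idPr ->|/dim_cap_hyperplane ->].
  by rewrite mul0r subrr.
by rewrite mulrBr mulr1 -exprSr [(x :&: _)%VS]capvC.
Qed.

Lemma del_restr_chart s x :
  del_restr chart_poly x s * ('X - 1) =
  del_restr (fun z => 'X^(\dim z) : {poly int}) x (i0 :: s).
Proof.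
elim: s x => [|i s IHs] x; first exact: chart_polyE.
rewrite /= mulrBl !IHs /= (capvA (hyp i)) [(hyp i :&: hyp i0)%VS]capvC -capvA.
by ring.
Qed.

(** Both sides agree after multiplication by X - 1, by Whitney's theorem for the
    list i0 :: s. *)
Lemma reduced_char_polyE s : (forall i, i \in s) ->
  reduced_char_poly H = del_restr chart_poly fullv s.
Proof.
move=> s_all; have X1 : 'X - 1 != 0 :> {poly int} by rewrite -polyC1 polyXsubC_eq0.
apply: (mulIf X1); rewrite -arr_char_polyE; last by case: i0 => i /(leq_ltn_trans _) ->.
rewrite del_restr_chart whitney => [|i]; last by rewrite inE s_all orbT.
by apply: eq_bigr => z _; rewrite -scaler_int intz.
Qed.

(** Deletion-restriction: H_i is either added to the equations F or to the
    polynomial to be inverted, as in the recursion defining [del_restr]. *)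
Lemma form_locus_class F s :
  K0_eq (kclass (locus_variety
          (rcons [seq form_poly l | l <- F] (form_poly (H i0) - 1))
          (\prod_(i <- s) form_poly (H i))))
        (keval (del_restr chart_poly
                  (\bigcap_(l <- F) central_hyperplane l)%VS s)
               (kclass (affine_space k 1))).
Proof.
elim: s F => [|i s IHs] F.
  rewrite big_nil /= /chart_poly; case: ifPn => xH.
    rewrite /keval size_poly0 /=; apply: K0_empty; first exact: locus_affine.
    by move=> A; apply: form_locus_empty.
  apply: K0_trans (K0_sym (kevalXn _ _)); apply: K0_trans (K0_sym (kexp_affine _ _)).
  by apply: K0_iso; apply: form_locus_affine_space.
rewrite big_cons.
have scis := locus_scissor (rcons [seq form_poly l | l <- F] (form_poly (H i0) - 1))
  (\prod_(i <- s) form_poly (H i)) (form_poly (H i)).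
apply: (K0_cancel (t := kclass _) (t' := keval _ _)) (IHs (H i :: F)).
apply: K0_trans (K0_catC _ _) _; apply: K0_trans (K0_sym scis) _.
apply: K0_trans (IHs F) _; rewrite /= big_cons.
by apply: K0_trans (kevalD _ _ _); rewrite subrK; apply: K0_refl.
Qed.

End Decone.
End DeletionRestriction.

(** * Units, idempotents and lines as direct summands *)

Lemma unit_prod (R : comNzRingType) (I : eqType) (s : seq I) (a : I -> R) :
  (exists u, (\prod_(i <- s) a i) * u = 1) <->
  forall i, i \in s -> exists u, a i * u = 1.
Proof.
elim: s => [|i s IHs].
  by rewrite big_nil; split=> // _; exists 1; rewrite mulr1.
rewrite big_cons; split=> [[u asu] j|as1].
  rewrite inE => /predU1P[->|].
    by exists ((\prod_(j <- s) a j) * u); rewrite mulrA.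
  by move: j; apply/IHs; exists (a i * u); rewrite mulrCA mulrA.
have [u au] := as1 i (mem_head _ _).
have [|t at1] := IHs.2; first by move=> j js; apply: as1; rewrite inE js orbT.
by exists (u * t); rewrite mulrACA au at1 mulr1.
Qed.

(** The determinant of 1 - e takes the value 1 at every field, so it is a unit by
    [residue_field]; then 1 - e is invertible, and (1 - e) e = 0. *)
Lemma idempotent_mx_eq0 (R : comNzRingType) m (e : 'M[R]_m) : e *m e = e ->
  (forall (F : fieldType) (f : {rmorphism R -> F}), map_mx f e = 0) -> e = 0.
Proof.
move=> ee eF; pose D := \det (1%:M - e).
have [[u uD]|Dnu] := pselect (exists u, u * D = 1); last first.
  have [|F [f fD]] := @residue_field R D; first by move=> u uD; apply: Dnu; exists u.
  have /eqP[] := oner_neq0 F.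
  by rewrite -fD -det_map_mx map_mxB map_mx1 eF subr0 det1.
have : \adj (1%:M - e) *m ((1%:M - e) *m e) = 0.
  by rewrite mulmxBl mul1mx ee subrr mulmx0.
rewrite mulmxA mul_adj_mx mul_scalar_mx -/D => De.
by rewrite -[e]scale1r -uD -scalerA De scaler0.
Qed.

Section RankOneSummands.
Variables (k : fieldType) (n : nat).
Implicit Types (A B : comAlgType k).

Definition line A (V : 'rV[A]_n.+1) (w : 'rV[A]_n.+1) : Prop :=
  exists a : A, w = a *: V.

Section Line.
Variables (A : comAlgType k) (V : 'rV[A]_n.+1) (l : 'cV[A]_n.+1).
Hypothesis Vl : V *m l = 1%:M.

Lemma lineP w : line V w <-> exists u : 'rV[A]_n.+1, w = u *m (l *m V).
Proof.
split=> [[a ->]|[u ->]].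
  by exists (a *: V); rewrite mulmxA -scalemxAl Vl -scalemxAl mul1mx.
exists ((u *m l) 0 0).
by rewrite mulmxA [in LHS](mx11_scalar (u *m l)) mul_scalar_mx.
Qed.

(** If V l = 1 then l V is a projector onto the line spanned by V. *)
Lemma line_summand : rank1_summand (line V).
Proof.
exists (l *m V); split; [|exact: lineP|].
  by rewrite mulmxA -(mulmxA l) Vl mulmx1.
move=> F f; rewrite map_mxM; apply/eqP; rewrite eqn_leq mulmx_max_rank /=.
rewrite lt0n mxrank_eq0; apply: contraNneq (oner_neq0 F) => lV0.
have : map_mx f (V *m (l *m V) *m l) 0 0 = 1.
  by rewrite mulmxA Vl mul1mx Vl map_mx1 mxE eqxx.
by rewrite !map_mxM lV0 mulmx0 mul0mx mxE => ->.
Qed.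

End Line.

Lemma span_ext_line A B (f : {lrmorphism A -> B}) (V : 'rV[A]_n.+1) w :
  span_ext f (line V) w <-> line (map_mx f V) w.
Proof.
split=> [[m [b [M [MV ->]]]]|[b ->]].
  have /choice[a aP] := MV; exists (\sum_i b 0 i * f (a i)).
  rewrite mulmx_sum_row scaler_suml; apply: eq_bigr => i _.
  by rewrite -map_row aP map_mxZ scalerA.
exists 1%N, b%:M, V; split=> [i|]; last by rewrite mul_scalar_mx.
by exists 1; rewrite scale1r row_id.
Qed.

(** With e a projector onto L and N = 1 - l V the projector onto the kernel of l
    along V, the product e N is a projector onto the kernel of l in L.  At every
    field L is a line spanned by V, so e N vanishes there; hence e N = 0 by
    [idempotent_mx_eq0], and each t e in L equals (t e l) V. *)
Lemma summand_line A (L : 'rV[A]_n.+1 -> Prop) (V : 'rV[A]_n.+1)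
    (l : 'cV[A]_n.+1) :
  rank1_summand L -> L V -> V *m l = 1%:M -> forall w, L w <-> line V w.
Proof.
move=> [e [ee LE e1]] LV Vl w; have [u VE] := (LE V).1 LV.
have Ve : V *m e = V by rewrite VE -mulmxA ee.
pose N := 1%:M - l *m V.
have Ne : N *m e = e - l *m V by rewrite mulmxBl mul1mx -mulmxA Ve.
have NN : N *m N = N.
  rewrite /N mulmxBr mulmx1 mulmxBl mul1mx mulmxA -(mulmxA l) Vl mulmx1.
  by rewrite subrr subr0.
have : e *m N = 0.
  apply: idempotent_mx_eq0 => [|F f].
    rewrite -mulmxA (mulmxA N) Ne [LHS]mulmxA (mulmxBr e e) ee.
    by rewrite -{1}[e]mulmx1 -mulmxBr -mulmxA NN.
  have VFl : map_mx f V *m map_mx f l = 1%:M by rewrite -map_mxM Vl map_mx1.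
  have VF0 : map_mx f V != 0.
    apply: contraNneq (oner_neq0 F) => V0; move: VFl; rewrite V0 mul0mx.
    by move=> /matrixP/(_ 0 0); rewrite !mxE eqxx => ->.
  have Ve_sub : (map_mx f V <= map_mx f e)%MS by rewrite -Ve map_mxM submxMl.
  have /submxP[c eE] : (map_mx f e <= map_mx f V)%MS.
    by rewrite -(geq_leqif (mxrank_leqif_sup Ve_sub)) (e1 F f) lt0n mxrank_eq0.
  rewrite /N map_mxM map_mxB map_mx1 map_mxM mulmxBr mulmx1 eE mulmxA.
  by rewrite -(mulmxA c) VFl mulmx1 subrr.
rewrite /N mulmxBr mulmx1 => /eqP; rewrite subr_eq0 => /eqP eE.
split=> [/LE[t ->]|[a ->]].
  exists ((t *m e *m l) 0 0).
  by rewrite [in LHS]eE 2!mulmxA [in LHS](mx11_scalar (t *m e *m l)) mul_scalar_mx.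
by apply/LE; exists (a *: V); rewrite -scalemxAl Ve.
Qed.

End RankOneSummands.

(** * The complement of the arrangement *)

Section ComplementAsLocus.
Variables (k : fieldType) (n d : nat) (H : arrangement k n d).
Implicit Types A B : comAlgType k.
Local Notation hmx A i := (map_mx (in_alg A) (H i)).

(** By linearity it suffices to test a form on the generators of the extension
    of L to B. *)
Lemma span_extP A B (f : {lrmorphism A -> B}) (L : 'rV[A]_n.+1 -> Prop)
    (l : 'cV[k]_n.+1) :
  (forall w, span_ext f L w -> w *m map_mx (in_alg B) l = 0) <->
  (forall w, L w -> f ((w *m map_mx (in_alg A) l) 0 0) = 0).
Proof.
have fE w : f ((w *m map_mx (in_alg A) l) 0 0) =
            (map_mx f w *m map_mx (in_alg B) l) 0 0.
  by rewrite -(map_in_alg f) -map_mxM [RHS]mxE.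
split=> [Ll w Lw|Ll _ [m [b [M [LM ->]]]]].
  rewrite fE Ll ?mxE //; exists 1%N, 1%:M, w; split; last by rewrite mul1mx.
  by move=> i; rewrite row_id.
rewrite -mulmxA (_ : _ *m map_mx _ l = 0) ?mulmx0 //.
apply/row_matrixP => i; apply/rowP => j; rewrite row_mul row0 (ord1 j) [RHS]mxE.
by rewrite -map_row -fE Ll.
Qed.

Lemma arr_complP A (L : proj_space k n A) :
  @compl_pred k _ (arr_union H) A L <->
  forall i B (f : {lrmorphism A -> B}),
    ~ forall w, sval L w -> f ((w *m hmx A i) 0 0) = 0.
Proof.
split=> [LH i B f /span_extP Lf|LH B f [i Li]]; first by apply: (LH B f); exists i.
by apply: (LH i B f); apply/span_extP.
Qed.

Variable i0 : 'I_d.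

(** The values of l_0 on L form an ideal, which is proper iff L meets H_0 over
    some nonzero algebra. *)
Lemma arr_compl_section A (L : arr_compl H A) :
  exists2 V, sval (sval L) V & V *m hmx A i0 = 1%:M.
Proof.
case: L => -[L /= Lsum] /arr_complP Lc.
have [e [ee LE _]] := Lsum.
(* The image of L under l_0; an algebra killing it would give a point of H_0. *)
pose I a := exists2 w, L w & (w *m hmx A i0) 0 0 = a.
have [|B f If|V LV V1] := @ideal_full k A I.
- split.
  + exists 0; last by rewrite mul0mx mxE.
    by apply/LE; exists 0; rewrite mul0mx.
  + move=> _ _ [v /LE[t ->] <-] [w /LE[u ->] <-].
    exists ((t + u) *m e); last by rewrite !mulmxDl mxE.
    by apply/LE; exists (t + u).
  + move=> a _ [w /LE[u ->] <-]; exists (a *: u *m e).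
      by apply/LE; exists (a *: u).
    by rewrite -!scalemxAl mxE.
- by apply: (Lc i0 B f) => w Lw; apply: If; exists w.
- by exists V => //; apply/rowP => j; rewrite (ord1 j) V1 mxE eqxx.
Qed.

Lemma arr_compl_line A (V : 'rV[A]_n.+1) (VP : rank1_summand (line V)) :
  @compl_pred k _ (arr_union H) A (exist _ (line V) VP) <->
  forall i, exists u, (V *m hmx A i) 0 0 * u = 1.
Proof.
rewrite arr_complP /=; split=> [VH i|VH i B f Vi].
  apply: unit_of_nonzero => B f fV; apply: (VH i B f) => _ [a ->].
  by rewrite -scalemxAl mxE rmorphM /= fV mulr0.
by apply: (unit_nonzero (f := f) (VH i)); apply: Vi; exists 1; rewrite scale1r.
Qed.

(** The map v |-> A v identifies the vectors v with l_0(v) = 1 and all l_i(v)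
    invertible with the points of the complement.  It is injective since l_0
    fixes the scalar, and surjective by [arr_compl_section] and
    [summand_line]. *)
Lemma arr_compl_locus s : (forall i, i \in s) ->
  kiso (arr_compl H)
       (locus [:: form_poly (H i0) - 1] (\prod_(i <- s) form_poly (H i))).
Proof.
move=> s_all; apply: kiso_sym.
set q := \prod_(i <- s) _.
have VP A (v : locus [:: form_poly (H i0) - 1] q A) :
    (\row_j sval v j) *m hmx A i0 = 1%:M /\
    forall i, exists u, ((\row_j sval v j) *m hmx A i) 0 0 * u = 1.
  have : locus_pred [:: form_poly (H i0) - 1] q ((\row_j sval v j) 0).
    rewrite (_ : (\row_j sval v j) 0 = sval v); first exact: svalP.
    by apply/funext => j; rewrite mxE.
  case/(form_locusP _ [::]) => _ v0 vq; split.
    by apply/rowP => j; rewrite (ord1 j) v0 mxE eqxx.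
  move=> i; rewrite -eval_form_poly.
  move: i (s_all i); apply/unit_prod.
  by move: vq; rewrite /q /mpoly_eval rmorph_prod.
pose u A v : arr_compl H A :=
  exist _ (exist _ _ (line_summand (VP A v).1))
    ((arr_compl_line (line_summand (VP A v).1)).2 (VP A v).2).
apply: (kiso_bij (u := u)) => [A B f v|A v w vw|A L].
- apply/eq_exist/eq_exist/funext => w; apply/propext => /=.
  rewrite span_ext_line (_ : map_mx f _ = \row_j f (sval v j)) //.
  by apply/rowP => j; rewrite !mxE.
- have [vl _] := VP A v; have [wl _] := VP A w.
  have vw' : line (\row_j sval v j) = line (\row_j sval w j).
    by have /(congr1 (fun x => sval (sval x))) := vw.
  have [a wE] : line (\row_j sval v j) (\row_j sval w j).
    by rewrite vw'; exists 1; rewrite scale1r.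
  have a1 : a = 1.
    have /matrixP/(_ 0 0) := wl; rewrite wE -scalemxAl vl !mxE eqxx.
    by rewrite mulr1.
  case: v w wE {vw vl wl vw'} => [v vP] [w wP] /=; rewrite a1 scale1r => /rowP wv.
  by apply/eq_exist/funext => j; have := wv j; rewrite !mxE.
- have [V LV V1] := arr_compl_section L.
  case: L LV => -[L Lsum] Lc /= LV.
  have LE := summand_line Lsum LV V1.
  have LV' : L = line V by apply/funext => w; apply/propext/LE.
  subst L; have Vu := (arr_compl_line Lsum).1 Lc.
  have Vq : locus_pred [:: form_poly (H i0) - 1] q (V 0).
    apply/(form_locusP _ [::]); split=> //.
      by rewrite V1 mxE eqxx.
    rewrite /q /mpoly_eval rmorph_prod; apply/unit_prod => i _.
    by have := Vu i; rewrite -eval_form_poly.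
  exists (exist _ _ Vq); do 2!apply: eq_exist; rewrite /=.
  by congr line; apply/rowP => j; rewrite mxE.
Qed.

End ComplementAsLocus.

Theorem theorem1p1 (k : fieldType) (n d : nat) (H : arrangement k n d)
    (hd : (2 <= d)%N) :
  exists MP : is_variety (arr_compl H),
    K0_eq (kclass (Variety MP))
      (keval (reduced_char_poly H) (kclass (affine_space k 1))).
Proof.
pose i0 : 'I_d := Ordinal (ltnW hd); pose s := enum 'I_d.
have s_all i : i \in s by rewrite mem_enum.
have MH := arr_compl_locus H i0 s_all.
pose Y := locus_variety [:: form_poly (H i0) - 1]
  (\prod_(i <- s) form_poly (H i)).
exists (affine_variety (affine_ft_iso MH (locus_affine _ _))).
apply: (K0_trans (t := kclass Y)); first exact: K0_iso.
rewrite (reduced_char_polyE H i0 s_all).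
by have := form_locus_class H i0 [::] s; rewrite big_nil.
Qed.
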